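(* Let $(F_n)_{n\in\mathbb{N}}$ be a sequence of quasi-infinitely divisible distribution functions with spectral pairs $(\gamma_n,G_n)$, $\gamma_n\in\mathbb{R}$, $G_n\in\boldsymbol{V}$, $n\in\mathbb{N}$. Suppose that for some decompositions $$G_n(x)=G_n^+(x)-G_n^-(x),\quad x\in\mathbb{R},\ n\in\mathbb{N},$$ with non-decreasing functions $G_n^+,G_n^-\in\boldsymbol{V}$, one has $\varlimsup_{n\to\infty}G_n^-(+\infty)<\infty$. If $(F_n)_{n\in\mathbb{N}}$ is relatively compact and $\gamma_n\to\gamma$, $G_n\Rightarrow G$ (basic convergence), and $G_n(+\infty)\to G(+\infty)$, $n\to\infty$, with some $\gamma\in\mathbb{R}$ and $G\in\boldsymbol{V}$, then $(\gamma,G)$ is the spectral pair for a quasi-infinitely divisible distribution function $F$ and the sequence $(F_n)_{n\in\mathbb{N}}$ weakly converges to $F$.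
   Context: $\boldsymbol{V}$ denotes the class of all functions $G:\mathbb{R}\to\mathbb{R}$ of bounded variation on $\mathbb{R}$ that are right-continuous at every point and satisfy $G(-\infty)=0$, where $G(\pm\infty)$ denote the limits at $\pm\infty$. Integrals $\int_{\mathbb{R}} h\,dG$ are with respect to the finite signed Lebesgue--Stieltjes measure $\mu_G$ with $\mu_G((a,b])=G(b)-G(a)$. A number $\tau>0$ is fixed throughout. A (probability) distribution function $F$ on $\mathbb{R}$ is quasi-infinitely divisible if its characteristic function $f(t)=\int_{\mathbb{R}}e^{itx}\,dF(x)$ has the form $$f(t)=\exp\Bigl\{it\gamma+\int_{\mathbb{R}}\Bigl(e^{itx}-1-\tfrac{it}{\tau}\sin(\tau x)\Bigr)\tfrac{1+x^2}{x^2}\,dG(x)\Bigr\},\quad t\in\mathbb{R},$$ with some $\gamma\in\mathbb{R}$ and $G\in\boldsymbol{V}$ (the integrand at $x=0$ is defined by continuity, i.e. equals $-t^2/2$). The pair $(\gamma,G)$ is uniquely determined by $F$ and is called its spectral pair. (The property does not depend on $\tau$; $\gamma$ depends on $\tau$ but $G$ does not. All spectral pairs are taken with the same fixed $\tau$.) Basic convergence: for $G_n,G\in\boldsymbol{V}$, $(G_n)_{n\in\mathbb{N}}$ converges basically to $G$, written $G_n\Rightarrow G$, $n\to\infty$, if every subsequence of $(G_n)_{n\in\mathbb{N}}$ contains a further subsequence $(G_{n_k})_{k\in\mathbb{N}}$ for which there is an at most countable set $D\subset\mathbb{R}$ (depending in general on the choice of the subsequences) such that $G_{n_k}(x_2)-G_{n_k}(x_1)\to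 G(x_2)-G(x_1)$, $k\to\infty$, for all $x_1,x_2\in\mathbb{R}\setminus D$. Weak convergence of $(F_n)$ to $F$ means $\int_{\mathbb{R}}h\,dF_n\to\int_{\mathbb{R}}h\,dF$ for every bounded continuous $h:\mathbb{R}\to\mathbb{R}$. A sequence $(F_n)_{n\in\mathbb{N}}$ of distribution functions is relatively compact if every subsequence contains a further subsequence that weakly converges to a distribution function. *)

(* Defs.v *)
From HB Require Import structures.
From mathcomp Require Import all_boot all_order all_algebra complex.
From mathcomp Require Import all_classical all_reals all_analysis.

Set Implicit Arguments.
Unset Strict Implicit.
Unset Printing Implicit Defensive.

Import Order.TTheory GRing.Theory Num.Theory.
Import numFieldNormedType.Exports.

Local Open Scope classical_set_scope.
Local Open Scope ring_scope.

(* Distribution functions on the line are terms of [cumulativeBounded 0 1]: nondecreasing,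
   right-continuous, with limits 0 at -oo and 1 at +oo. *)

(* G(+oo); [lim] is the actual limit for every function in [class_V]. *)
Definition at_pinfty (R : realType) (G : R -> R) : R := lim (G @ +oo).

(* The uniform bound M over all compact intervals says that the total
   variation over the whole line is finite. *)
Definition bounded_variation_line (R : realType) (G : R -> R) : Prop :=
  exists M : R, forall a b : R, a <= b -> (total_variation a b G <= M%:E)%E.

Definition class_V (R : realType) : set (R -> R) :=
  [set G | [/\ bounded_variation_line G,
               right_continuous G
             & G @ -oo --> (0 : R)]].

Definition cexp (R : realType) (z : R[i]) : R[i] :=
  ((expR (complex.Re z))%:C * (cos (complex.Im z) +i* sin (complex.Im z)))%C.

Definition complex_integral (R : realType)
    (mu : {measure set (measurableTypeR R) -> \bar R}) (f : R -> R[i]) : R[i] :=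
  ((\int[mu]_x complex.Re (f x)) +i* (\int[mu]_x complex.Im (f x)))%C.

(* Integral with respect to a finite signed measure, by its Jordan
   decomposition; the value does not depend on the Hahn decomposition chosen,
   which is unique up to null sets. *)
Definition charge_integral (R : realType)
    (nu : {charge set (measurableTypeR R) -> \bar R}) (f : R -> R[i]) : R[i] :=
  let nuP := cid (Hahn_decomposition nu) in
  let nuPN := cid (projT2 nuP) in
  complex_integral (jordan_pos (projT2 nuPN)) f
  - complex_integral (jordan_neg (projT2 nuPN)) f.

(* nu is mu_G: a charge is finite and its values on the half-open intervals
   determine it, so for G in [class_V] there is exactly one such nu. *)
Definition is_stieltjes_charge (R : realType) (G : R -> R)
    (nu : {charge set (measurableTypeR R) -> \bar R}) : Prop :=
  forall a b : R, a <= b -> nu `]a, b]%classic = (G b - G a)%:E.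

Definition char_fun (R : realType) (F : cumulativeBounded (0 : R) (1 : R))
    (t : R) : R[i] :=
  complex_integral (lebesgue_stieltjes_measure F)
    (fun x => cexp ('i%C * (t * x)%:C%C)).

(* The value at x = 0 is the limit as x tends to 0. *)
Definition LK_kernel (R : realType) (tau t x : R) : R[i] :=
  if x == 0 then (- (t ^+ 2 / 2))%:C%C
  else (cexp ('i%C * (t * x)%:C%C) - 1
        - 'i%C * (t / tau * sin (tau * x))%:C%C)
       * ((1 + x ^+ 2) / x ^+ 2)%:C%C.

Definition spectral_pair (R : realType) (tau : R)
    (F : cumulativeBounded (0 : R) (1 : R)) (gamma : R) (G : R -> R) : Prop :=
  class_V G /\
  exists2 nu : {charge set (measurableTypeR R) -> \bar R},
    is_stieltjes_charge G nu
    & forall t : R, char_fun F t =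
        cexp ('i%C * (t * gamma)%:C%C + charge_integral nu (LK_kernel tau t)).

Definition quasi_infinitely_divisible (R : realType) (tau : R)
    (F : cumulativeBounded (0 : R) (1 : R)) : Prop :=
  exists gamma : R, exists G : R -> R, spectral_pair tau F gamma G.

(* k |-> u (phi k) with such a phi is a subsequence of u. *)
Definition extraction (phi : nat -> nat) : Prop :=
  {homo phi : m n / (m < n)%N}.

Definition basic_cvg (R : realType) (G_ : nat -> R -> R) (G : R -> R) : Prop :=
  forall phi : nat -> nat, extraction phi ->
  exists2 psi : nat -> nat, extraction psi &
  exists2 D : set R, countable D &
  forall x1 x2 : R, ~ D x1 -> ~ D x2 ->
    (G_ (phi (psi k)) x2 - G_ (phi (psi k)) x1) @[k --> \oo] --> G x2 - G x1.

Definition weak_cvg (R : realType)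
    (F_ : nat -> cumulativeBounded (0 : R) (1 : R))
    (F : cumulativeBounded (0 : R) (1 : R)) : Prop :=
  forall h : R -> R, continuous h -> bounded_fun h ->
    \int[lebesgue_stieltjes_measure (F_ n)]_x h x @[n --> \oo]
      --> \int[lebesgue_stieltjes_measure F]_x h x.

Definition relatively_compact (R : realType)
    (F_ : nat -> cumulativeBounded (0 : R) (1 : R)) : Prop :=
  forall phi : nat -> nat, extraction phi ->
  exists2 psi : nat -> nat, extraction psi &
  exists F : cumulativeBounded (0 : R) (1 : R),
    weak_cvg (fun k => F_ (phi (psi k))) F.

(* Main.v *)
Require Import Defs.
From HB Require Import structures.
From mathcomp Require Import all_boot all_order all_algebra complex.
From mathcomp Require Import all_classical all_reals all_analysis.
From mathcomp Require Import measurable_realfun ring lra.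

Set Implicit Arguments.
Unset Strict Implicit.
Unset Printing Implicit Defensive.

Import Order.TTheory GRing.Theory Num.Theory.
Import numFieldNormedType.Exports.

Local Open Scope classical_set_scope.
Local Open Scope ring_scope.

(** The idea. Write the characteristic function of F_n as exp (c_n + i s_n), where
  c_n (t) and s_n (t) - t * gamma_n are the integrals against dG_n of the real and
  the imaginary part of the kernel.  It is enough to show that c_n and s_n converge
  pointwise, along any subsequence on which F_n converges weakly and the increments
  of G_n converge off a countable set, to the same expressions c and s formed from
  (gamma, G): the weak limit then has characteristic function exp (c + i s), so it is
  the same distribution for every such subsequence, and relative compactness
  concludes.

  The total variations of the G_n are bounded: G_n^- (+oo) is bounded by hypothesis
  and G_n^+ (+oo) = G_n (+oo) + G_n^- (+oo).  Hence integrals of continuous functions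
  vanishing at infinity converge ([vague_cvg]).  The kernel does not vanish at
  infinity, and mass of G_n may escape there; two facts make up for this.

  First, c_n and s_n are equicontinuous.  Weak convergence makes the
  characteristic functions equicontinuous ([weak_cvg_equicont]); since c_n is bounded,
  they stay away from 0, and a continuous argument of a function that moves little
  moves little itself ([polar_lift]).

  Secondly, averaging the kernel over a window of parameters [t - d, t + d] multiplies
  its oscillating part by sin (d x) / (d x), which vanishes at infinity, and leaves
  the part affine in t untouched.  The affine part is removed by a linear combination
  with a second parameter at which the integral is zero: t = 0 for the real part,
  t = tau for the imaginary part, where the centering sin (tau x) cancels it.  By the
  mean value theorem an average is a value at a nearby parameter, hence close to the
  value at t by equicontinuity.  So c_n (t) and s_n (t) differ little from the integral
  of a function vanishing at infinity, uniformly in n ([kernel_cvg]).  In particular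
  gamma is not shifted in the limit, because s_n (tau) = tau * gamma_n.

  Uniqueness of characteristic functions is proved by integrating twice with respect
  to a parameter: from cos (t u) to the Cauchy density 1 / (1 + u^2), and from there
  to arctan, whose rescalings converge boundedly to indicators of half-lines. *)

(** * Elementary inequalities for sine and cosine *)

Section trig.
Context {R : realType}.
Implicit Types u x t : R.

Lemma ge0_of_deriv_ge0 (f df : R -> R) :
  f 0 = 0 -> (forall x, is_derive x 1 f (df x)) ->
  (forall x, 0 <= x -> 0 <= df x) -> forall x, 0 <= x -> 0 <= f x.
Proof.
move=> f0 fdf df0 x x0.
have cf : {within `[0, x], continuous f}.
  apply: continuous_subspaceT => y.
  by apply/differentiable_continuous/derivable1_diffP; case: (fdf y).
have [c c0x] := MVT_segment x0 (fun y _ => fdf y) cf.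
rewrite f0 !subr0 => ->; rewrite mulr_ge0// df0//.
by move: c0x; rewrite in_itv/= => /andP[].
Qed.

Lemma le_sin_id u : 0 <= u -> sin u <= u.
Proof.
move=> u0; rewrite -subr_ge0.
apply: (@ge0_of_deriv_ge0 (fun x => x - sin x) (fun x => 1 - cos x)) => //.
- by rewrite sin0 subrr.
Qed.

Lemma ge_cos_sub_sq u : 0 <= u -> 1 - u ^+ 2 / 2 <= cos u.
Proof.
move=> u0; rewrite -subr_ge0.
apply: (@ge0_of_deriv_ge0 (fun x => cos x - (1 - x ^+ 2 / 2))
   (fun x => x - sin x)) => //.
- by rewrite cos0; ring.
- move=> x; apply: is_derive_eq.
  by rewrite /GRing.scale/=; field.
- by move=> x x0; rewrite subr_ge0; exact: le_sin_id.
Qed.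

Lemma ge_sin_sub_cube u : 0 <= u -> u - u ^+ 3 / 6 <= sin u.
Proof.
move=> u0; rewrite -subr_ge0.
apply: (@ge0_of_deriv_ge0 (fun x => sin x - (x - x ^+ 3 / 6))
   (fun x => cos x - (1 - x ^+ 2 / 2))) => //.
- by rewrite sin0; ring.
- move=> x; apply: is_derive_eq.
  by rewrite /GRing.scale/=; field.
- by move=> x x0; rewrite subr_ge0; exact: ge_cos_sub_sq.
Qed.

Lemma le_cos_taylor4 u : 0 <= u -> cos u <= 1 - u ^+ 2 / 2 + u ^+ 4 / 24.
Proof.
move=> u0; rewrite -subr_ge0.
apply: (@ge0_of_deriv_ge0 (fun x => 1 - x ^+ 2 / 2 + x ^+ 4 / 24 - cos x)
   (fun x => sin x - (x - x ^+ 3 / 6))) => //.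
- by rewrite cos0; ring.
- move=> x; apply: is_derive_eq.
  by rewrite /GRing.scale/=; field.
- by move=> x x0; rewrite subr_ge0; exact: ge_sin_sub_cube.
Qed.

Lemma abs_cos u : cos `|u| = cos u.
Proof. by have [_|_] := ger0P u => //; rewrite cosN. Qed.

Lemma one_sub_cos_bounds u : u ^+ 2 / 2 - u ^+ 4 / 24 <= 1 - cos u <= u ^+ 2 / 2.
Proof.
rewrite -abs_cos -(real_normK (num_real u)) (_ : u ^+ 4 = `|u| ^+ 4); last first.
  by rewrite -normrX ger0_norm// exprn_even_ge0.
have := ge_cos_sub_sq (normr_ge0 u); have := le_cos_taylor4 (normr_ge0 u).
set c := cos _; lra.
Qed.

Lemma abs_sin_sub_id u : `|sin u - u| = `|u| - sin `|u|.
Proof.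
have [u0|u0] := ger0P u.
  by rewrite -normrN opprB ger0_norm// subr_ge0 le_sin_id.
rewrite sinN ger0_norm ?opprK 1?addrC//.
have := @le_sin_id (- u); rewrite sinN; lra.
Qed.

Lemma abs_sin_sub_id_cube u : `|sin u - u| <= `|u| ^+ 3 / 6.
Proof.
rewrite abs_sin_sub_id; have := ge_sin_sub_cube (normr_ge0 u); lra.
Qed.

Lemma abs_sin_le u : `|sin u| <= `|u|.
Proof.
wlog u0 : u / 0 <= u.
  move=> h; have [u0|u0] := leP 0 u; first exact: h.
  by rewrite -normrN -sinN -[leRHS]normrN h//; lra.
have [up|up] := leP 1 u.
  by rewrite (le_trans (sin_max u))// ger0_norm.
rewrite ler_norml ger0_norm// le_sin_id// andbT.
have := ge_sin_sub_cube u0.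
have : u ^+ 3 <= u by rewrite exprS -[leRHS]mulr1 ler_wpM2l// expr_le1// ltW.
lra.
Qed.

(** A bound of the second order valid on the whole line: the cubic bound gives it near
  0 and the linear bound away from 0. *)
Lemma abs_sin_sub_id_sq u : `|sin u - u| <= u ^+ 2.
Proof.
rewrite -(real_normK (num_real u)); have := normr_ge0 u.
have [u2 u0|u2 u0] := leP `|u| 6.
  rewrite (le_trans (abs_sin_sub_id_cube u))// exprS; nra.
rewrite (le_trans (ler_normB _ _))//.
have := abs_sin_le u; nra.
Qed.

Lemma abs_sinB_le u x : `|sin u - sin x| <= `|u - x|.
Proof.
have -> : sin u - sin x = 2 * cos ((u + x) / 2) * sin ((u - x) / 2).
  have -> : sin u = sin ((u + x) / 2 + (u - x) / 2) by congr sin; field.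
  have -> : sin x = sin ((u + x) / 2 - (u - x) / 2) by congr sin; field.
  by rewrite sinD sinB; ring.
rewrite !normrM (ger0_norm (_ : 0 <= 2))//.
have := cos_max ((u + x) / 2); have := abs_sin_le ((u - x) / 2).
rewrite normrM (ger0_norm (_ : 0 <= 2^-1 :> R)) ?invr_ge0//.
have := normr_ge0 (cos ((u + x) / 2)); have := normr_ge0 (sin ((u - x) / 2)).
have := normr_ge0 (u - x).
move: `|cos _| `|sin _| `|u - x| => a b c; nra.
Qed.

Lemma abs_cosB_le u x : `|cos u - cos x| <= `|u - x|.
Proof.
rewrite -[u](subrK (pi/2)) -[x](subrK (pi/2)) !cosDpihalf.
rewrite -opprD normrN (le_trans (abs_sinB_le _ _))//.
by rewrite opprD addrACA subrr addr0 !subrK.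
Qed.

End trig.

(** * Bounded functions and finite measures on the line *)

Section finite_measures.
Context {R : realType}.
Local Notation Meas := {measure set (measurableTypeR R) -> \bar R}.
Implicit Types (mu nu : Meas) (h : R -> R).

Definition bounded_measurable h := measurable_fun [set: measurableTypeR R] h /\
  exists C, forall x, `|h x| <= C.

Lemma bounded_measurable_continuous h (C : R) : continuous h -> (forall x, `|h x| <= C) -> bounded_measurable h.
Proof.
by move=> ch hC; split; [exact: continuous_measurable_fun|exists C].
Qed.

Lemma bounded_measurable_integrable mu h : (mu setT < +oo)%E -> bounded_measurable h ->
  mu.-integrable setT (EFin \o h).
Proof.
move=> fmu [mh [C hC]]; apply: measurable_bounded_integrable => //.
exists C; split; first exact: num_real.
by move=> M CM x _ /=; exact: le_trans (hC x) (ltW CM).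
Qed.

Lemma le_normr_int mu h (C : R) : (mu setT < +oo)%E ->
  measurable_fun [set: measurableTypeR R] h -> (forall x, `|h x| <= C) ->
  `|\int[mu]_x h x| <= C * fine (mu setT).
Proof.
move=> fmu mh hC; have bh : bounded_measurable h by split=> //; exists C.
rewrite (le_trans (le_normr_Rintegral _ (bounded_measurable_integrable fmu bh)))//.
rewrite -Rintegral_cst//; apply: le_Rintegral => //.
- apply: bounded_measurable_integrable => //; split; first exact: measurableT_comp.
  by exists C => x; rewrite normr_id.
- apply: bounded_measurable_integrable => //; split; first exact: measurable_cst.
  by exists `|C|.
Qed.

Lemma cvg_int_bounded mu (h_ : nat -> R -> R) h (C : R) : (mu setT < +oo)%E ->
  (forall n, measurable_fun [set: measurableTypeR R] (h_ n)) ->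
  (forall n x, `|h_ n x| <= C) ->
  (forall x, h_ n x @[n --> \oo] --> h x) ->
  \int[mu]_x h_ n x @[n --> \oo] --> \int[mu]_x h x.
Proof.
move=> fmu mh hC hcv.
have mhl : measurable_fun [set: measurableTypeR R] h.
  by apply: (measurable_fun_cvg mh) => x _; exact: hcv.
have hlC x : `|h x| <= C.
  rewrite -(cvg_lim _ (cvg_norm (hcv x)))//.
  by apply: limr_le; [apply/cvg_ex; exists `|h x|; exact: cvg_norm|exact: nearW].
have ih : mu.-integrable setT (EFin \o h).
  by apply: bounded_measurable_integrable => //; split => //; exists C.
apply: fine_cvg; rewrite fineK; last exact: integrable_fin_num.
apply: (@dominated_cvg _ _ _ mu setT _ (fun n x => (h_ n x)%:E) (EFin \o h)
  (cst C%:E)) => //=.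
- by move=> n; apply/measurable_EFinP.
- by move=> x _; apply: cvg_EFin; [exact: nearW|exact: hcv].
- apply: (@bounded_measurable_integrable mu (cst C)) => //; split; first exact: measurable_cst.
  by exists `|C|.
- by move=> n x _; rewrite lee_fin.
Qed.

(** The intervals ]a, b] are stable under intersection and generate the Borel sets. *)
Lemma eq_finite_measure_ocitv mu nu : (mu setT < +oo)%E ->
  (forall a b, a <= b -> mu `]a, b]%classic = nu `]a, b]%classic) ->
  forall A, measurable A -> mu A = nu A.
Proof.
move=> fmu h; apply: (@measure_unique _ R (measurableTypeR R) (@ocitv R)
  (fun n => `](- n%:R), n%:R]%classic)) => //.
- exact: (@ocitvI R).
- by move=> i; exact: is_ocitv.
- exact: (bigcup_itvT false false).
- move=> _ [[a b] _ <-]/=; have [ab|ba] := leP a b; first exact: h.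
  by rewrite set_itv_ge ?measure0// bnd_simp -leNgt ltW.
- move=> k; rewrite (le_lt_trans _ fmu)// le_measure ?inE//.
Qed.

Lemma eq_int_measure mu nu h :
  (forall A, measurable A -> mu A = nu A) -> \int[mu]_x h x = \int[nu]_x h x.
Proof. by move=> mn; congr fine; apply: eq_measure_integral => A mA _; exact: mn. Qed.

Lemma int_measure_add mu nu h : (mu setT < +oo)%E -> (nu setT < +oo)%E ->
  bounded_measurable h -> \int[measure_add mu nu]_x h x = \int[mu]_x h x + \int[nu]_x h x.
Proof.
move=> fmu fnu bh; rewrite /Rintegral integral_measure_add//;
  try exact: bounded_measurable_integrable.
by rewrite fineD//; apply: integrable_fin_num => //; exact: bounded_measurable_integrable.
Qed.

End finite_measures.

(** * Lebesgue-Stieltjes measures and charges *)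

Section stieltjes.
Context {R : realType}.
Local Notation Meas := {measure set (measurableTypeR R) -> \bar R}.
Local Notation ls := (@lebesgue_stieltjes_measure R).
Implicit Types (A B : cumulative R R) (h : R -> R).

Lemma lebesgue_stieltjes_itv A a b : a <= b -> ls A `]a, b]%classic = (A b - A a)%:E.
Proof.
move=> ab; rewrite /lebesgue_stieltjes_measure /measure_extension/=.
by rewrite measurable_mu_extE/= ?wlength_itv_bnd//; exact: is_ocitv.
Qed.

Lemma lebesgue_stieltjes_setT_le A (l u : R) : (forall x, l <= A x <= u) ->
  (ls A setT <= (u - l)%:E)%E.
Proof.
move=> lu; rewrite -(bigcup_itvT false false).
have cv : ls A `](- n%:R), n%:R] @[n --> \oo] -->
    ls A (\bigcup_n `](- n%:R), n%:R]%classic).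
  apply: nondecreasing_cvg_mu => //; first exact: bigcup_measurable.
  by move=> *; apply/subsetPset/subset_itv; rewrite leBSide/= ?lerN2 ler_nat.
rewrite -(cvg_lim _ cv)//; apply: lime_le; first by apply/cvg_ex; eexists; exact: cv.
apply: nearW => n; rewrite lebesgue_stieltjes_itv ?lee_fin; last first.
  by rewrite (@le_trans _ _ 0)// oppr_le0.
have /andP[_ ?] := lu n%:R; have /andP[? _] := lu (- n%:R).
by rewrite lerB.
Qed.

(** Gives access to the Lebesgue-Stieltjes measure of a function whose monotonicity
  and right-continuity are only known as hypotheses. *)
Definition mk_cumulative (f : R -> R) (nd : {homo f : x y / x <= y})
  (rc : right_continuous f) : cumulative R R :=
  HB.pack f (isCumulative.Build R _ R f nd rc).

(** The identity pos - neg = A - B holds on the intervals ]a, b], where both sides are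
  increments of G.  Written as an equality of sums of finite measures,
  pos + B = A + neg, it extends to all Borel sets, and can be integrated. *)
Lemma jordan_int_eq (G : R -> R) (A B : cumulative R R)
  (nu : {charge set (measurableTypeR R) -> \bar R})
  (P N : set (measurableTypeR R)) (PN : hahn_decomposition nu P N) h :
  (ls A setT < +oo)%E -> (ls B setT < +oo)%E ->
  (forall x, G x = A x - B x) -> is_stieltjes_charge G nu -> bounded_measurable h ->
  \int[jordan_pos PN]_x h x - \int[jordan_neg PN]_x h x =
  \int[ls A]_x h x - \int[ls B]_x h x.
Proof.
move=> fA fB GE nuG bh.
have fp : (jordan_pos PN setT < +oo)%E by rewrite ltey_eq fin_num_measure.
have fn : (jordan_neg PN setT < +oo)%E by rewrite ltey_eq fin_num_measure.
apply/eqP; rewrite subr_eq addrAC -subr_eq opprK; apply/eqP.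
rewrite -!int_measure_add//; apply: eq_int_measure.
apply: eq_finite_measure_ocitv => [|a b ab].
  by rewrite /= /measure_add/= /msum !big_ord_recl big_ord0 adde0/= lte_add_pinfty.
rewrite /= /measure_add/= /msum !big_ord_recl !big_ord0 !adde0/=.
have := nuG a b ab; rewrite (jordan_decomp PN)//= !GE.
rewrite [X in X = _]/cadd/= /cscale/= EFinN mulN1e.
rewrite !lebesgue_stieltjes_itv//.
have : jordan_pos PN `]a, b]%classic \is a fin_num by rewrite fin_num_measure.
have : jordan_neg PN `]a, b]%classic \is a fin_num by rewrite fin_num_measure.
move: (jordan_pos PN _) (jordan_neg PN _) => [x| |] [y| |]// _ _ [].
by rewrite -!EFinD => xy; congr EFin; lra.
Qed.

Lemma charge_integralE (G : R -> R) (A B : cumulative R R)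
  (nu : {charge set (measurableTypeR R) -> \bar R}) (f : R -> R[i]) :
  (ls A setT < +oo)%E -> (ls B setT < +oo)%E ->
  (forall x, G x = A x - B x) -> is_stieltjes_charge G nu ->
  bounded_measurable (fun x => complex.Re (f x)) -> bounded_measurable (fun x => complex.Im (f x)) ->
  charge_integral nu f =
  ((\int[ls A]_x complex.Re (f x) - \int[ls B]_x complex.Re (f x)) +i*
   (\int[ls A]_x complex.Im (f x) - \int[ls B]_x complex.Im (f x)))%C.
Proof.
move=> fA fB GE nuG bre bim; rewrite /charge_integral /complex_integral.
set PN := projT2 (cid (projT2 (cid (Hahn_decomposition nu)))).
rewrite -(jordan_int_eq PN fA fB GE nuG bre).
by rewrite -(jordan_int_eq PN fA fB GE nuG bim).
Qed.

Lemma stieltjes_charge_exists (G : R -> R) A B :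
  (ls A setT < +oo)%E -> (ls B setT < +oo)%E -> (forall x, G x = A x - B x) ->
  exists nu : {charge set (measurableTypeR R) -> \bar R}, is_stieltjes_charge G nu.
Proof.
move=> fA fB GE.
have mfin (C : cumulative R R) : (ls C setT < +oo)%E -> fin_num_fun (ls C).
  by move=> fC; apply: lty_fin_num_fun.
pose A' : {finite_measure set (measurableTypeR R) -> \bar R} :=
  HB.pack (ls A) (Measure_isFinite.Build _ _ _ (ls A) (mfin _ fA)).
pose B' : {finite_measure set (measurableTypeR R) -> \bar R} :=
  HB.pack (ls B) (Measure_isFinite.Build _ _ _ (ls B) (mfin _ fB)).
exists (cadd (charge_of_finite_measure A') (copp (charge_of_finite_measure B'))).
move=> a b ab; rewrite /= /cadd/= /copp/= /charge_of_finite_measure/=.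
by rewrite !lebesgue_stieltjes_itv// -EFinB !GE; congr EFin; lra.
Qed.

End stieltjes.

(** * Right-continuous functions of bounded variation *)

Section bv.
Context {R : realType}.
Local Notation ls := (@lebesgue_stieltjes_measure R).

(** The variation of [G] counted from the origin with a sign, so that its increments are
  total variations without any limit at -oo being taken. *)
Definition TVfun (G : R -> R) (x : R) : R :=
  if 0 <= x then fine (total_variation 0 x G) else - fine (total_variation x 0 G).

Section TVfun.
Variables (G : R -> R) (M : R).
Hypothesis GM : forall a b : R, a <= b -> (total_variation a b G <= M%:E)%E.

Let TVfin a b : a <= b -> total_variation a b G \is a fin_num.
Proof.
move=> ab; rewrite ge0_fin_numE ?total_variation_ge0//.
by rewrite (le_lt_trans (GM ab))// ltry.
Qed.

Let TVD a b c : a <= c -> c <= b -> fine (total_variation a b G) =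
  fine (total_variation a c G) + fine (total_variation c b G).
Proof.
by move=> ac cb; rewrite (total_variationD G ac cb) fineD// TVfin.
Qed.

Lemma TVfunB x y : x <= y -> TVfun G y - TVfun G x = fine (total_variation x y G).
Proof.
move=> xy; rewrite /TVfun; have [x0|x0] := leP 0 x; have [y0|y0] := leP 0 y.
- rewrite (TVD x0 xy); lra.
- lra.
- rewrite opprK addrC -TVD//; exact: ltW.
- rewrite opprK (TVD xy (ltW y0)); lra.
Qed.

Lemma TV_ge0 x y : x <= y -> 0 <= fine (total_variation x y G).
Proof. by move=> xy; rewrite fine_ge0// total_variation_ge0. Qed.

Lemma TV_le x y : x <= y -> fine (total_variation x y G) <= M.
Proof. by move=> xy; rewrite -lee_fin fineK ?TVfin// GM. Qed.

Lemma TV_ge x y : x <= y -> `|G y - G x| <= fine (total_variation x y G).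
Proof. by move=> xy; rewrite -lee_fin fineK ?TVfin// total_variation_ge. Qed.

Lemma TVfun_nd : {homo TVfun G : x y / x <= y}.
Proof. by move=> x y xy; rewrite -subr_ge0 TVfunB// TV_ge0. Qed.

Lemma TVfun_bounds x : - M <= TVfun G x <= M.
Proof.
rewrite /TVfun; have [x0|/ltW x0] := leP 0 x;
  have := TV_ge0 x0; have := TV_le x0; lra.
Qed.

(** The increment of [TVfun G] over [x, y] is the variation started at [x] itself, so
  right-continuity is that of the total variation at its own left end point. *)
Lemma TVfun_rc : right_continuous G -> right_continuous (TVfun G).
Proof.
move=> rcG x.
have xx1 : x < x + 1 by rewrite ltrDl.
have := @total_variation_right_continuous R x (x + 1) x G (lexx x) xx1 (rcG x).
move=> /(_ (proj2 (bounded_variationP G (ltW xx1)) (TVfin (ltW xx1)))).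
rewrite total_variationxx /= => h.
rewrite -[X in _ --> X]addr0.
apply: (cvg_trans _ (cvgD (cvg_cst (TVfun G x)) h)).
apply: near_eq_cvg; near=> y.
have xy : x <= y by near: y; exact: nbhs_right_ge.
change (TVfun G x + fine (total_variation x y G) = TVfun G y).
by rewrite -TVfunB// addrC subrK.
Unshelve. all: by end_near. Qed.

End TVfun.

(** [G = (T + G) - T], where [T] is the signed variation of [G]. *)
Lemma class_V_decomp (G : R -> R) : class_V G ->
  exists A B : cumulative R R, [/\ (ls A setT < +oo)%E, (ls B setT < +oo)%E &
    forall x, G x = A x - B x].
Proof.
move=> [[M GM] rcG _].
pose B := mk_cumulative (TVfun_nd GM) (TVfun_rc GM rcG).
have ndA : {homo (fun x => TVfun G x + G x) : x y / x <= y}.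
  move=> x y xy; have := TVfunB GM xy; have := TV_ge GM xy.
  rewrite ler_norml => /andP[]; lra.
have rcA : right_continuous (fun x => TVfun G x + G x).
  by move=> x; apply: cvgD; [exact: (TVfun_rc GM rcG)|exact: rcG].
pose A := mk_cumulative ndA rcA.
have G0 x : `|G x - G 0| <= M.
  have [x0|/ltW x0] := leP 0 x.
    exact: le_trans (TV_ge GM x0) (TV_le GM x0).
  by rewrite distrC; exact: le_trans (TV_ge GM x0) (TV_le GM x0).
exists A, B; split.
- apply: (@le_lt_trans _ _ ((M + (G 0 + M)) - (- M + (G 0 - M)))%:E); last exact: ltry.
  apply: lebesgue_stieltjes_setT_le => x /=.
  have := G0 x; have := TVfun_bounds GM x; rewrite ler_norml; lra.
- apply: (@le_lt_trans _ _ (M - - M)%:E); last exact: ltry.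
  by apply: lebesgue_stieltjes_setT_le => x /=; exact: TVfun_bounds.
- by move=> x /=; rewrite addrC addKr.
Qed.

End bv.

(** * Uniform approximation by step functions *)

Section vague.
Context {R : realType}.
Local Notation Meas := {measure set (measurableTypeR R) -> \bar R}.
Implicit Types (mu nu : Meas) (h : R -> R).

(** Uniform continuity on a segment, in the form where only one of the two points has to
  lie in the segment. *)
Lemma heine h (a b e : R) : continuous h -> 0 < e -> exists2 d, 0 < d &
  forall x y, a <= x <= b -> `|x - y| < d -> `|h x - h y| <= e.
Proof.
move=> ch e0; have /compact_near_coveringP nc := @segment_compact R a b.
(* Compactness in its near-covering form, the modulus d being the parameter. *)
have : \forall d \near 0^'+, `[a, b]%classic `<=`
    [set x | forall y, `|x - y| < d -> `|h x - h y| <= e].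
  apply: (nc R (0^'+) (fun d x => forall y, `|x - y| < d -> `|h x - h y| <= e)).
  move=> x _.
  have e2 : 0 < e / 2 by rewrite divr_gt0.
  have /cvgrPdist_lt/(_ _ e2)/nbhs_ballP[r/= r0 hr] := ch x.
  exists (ball x (r / 2), [set d | 0 < d < r / 2]) => /=.
    split; first by apply: nbhsx_ballx; rewrite divr_gt0.
    near=> d; apply/andP; split; near: d; first exact: nbhs_right_gt.
    by apply: nbhs_right_lt; rewrite divr_gt0.
  move=> [x' d]/= [xx' /andP[d0 dr]] y x'y.
  have h1 : `|h x - h x'| < e / 2.
    by apply: hr; rewrite /ball/= (lt_trans xx')// ltr_pdivrMr// ltr_pMr// ltr1n.
  have h2 : `|h x - h y| < e / 2.
    apply: hr; rewrite /ball/= -(subrK x' x) -addrA (le_lt_trans (ler_normD _ _))//.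
    by rewrite (splitr r) ltrD// (lt_trans x'y).
  rewrite -(subrK (h x) (h x')) -addrA (le_trans (ler_normD _ _))//.
  by rewrite (splitr e) lerD// ltW// distrC.
move=> near_d.
have [d [d0 hd]] : exists d, 0 < d /\ `[a, b]%classic `<=`
    [set x | forall y, `|x - y| < d -> `|h x - h y| <= e].
  near (0 : R)^'+ => d; exists d; split; first by near: d; exact: nbhs_right_gt.
  by near: d.
by exists d => // x y xab; apply: hd; rewrite /= in_itv.
Unshelve. all: by end_near. Qed.

(** A countable set is Lebesgue negligible, an interval is not. *)
Lemma countable_avoid (D : set R) (a b : R) : countable D -> a < b ->
  exists2 x, a < x < b & ~ D x.
Proof.
move=> cD ab; apply: contrapT => nex.
have sD : `]a, b[%classic `<=` D.
  move=> x /=; rewrite in_itv/= => xab; apply: contrapT => nDx.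
  by apply: nex; exists x.
have := countable_lebesgue_measure0 (sub_countable (subset_card_le sD) cD).
rewrite lebesgue_measure_itv/= lte_fin ab -EFinB => /eqP.
by rewrite eqe subr_eq0 => /eqP ba; move: ab; rewrite ba ltxx.
Qed.

Definition vanishing h := forall e, 0 < e -> exists A, forall x, A <= `|x| -> `|h x| <= e.

Definition stepfun m (y c : nat -> R) : R -> R :=
  fun x => \sum_(i < m) c i * \1_(`]y i, y i.+1]%classic) x.

(** The nodes are chosen one in each cell of a regular grid, which leaves enough freedom
  to avoid the countable set [D]. *)
Lemma step_approx (D : set R) h e : countable D -> continuous h -> vanishing h ->
  0 < e -> exists m y c,
  [/\ forall i, ~ D (y i), forall i, y i <= y i.+1 &
      forall x, `|h x - stepfun m y c x| <= e].
Proof.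
move=> cD ch vh e0.
have [A0 hA0] := vh _ e0.
pose A := Num.max A0 0.
have A_ge0 : 0 <= A by rewrite /A le_max lexx orbT.
have hA x : A <= `|x| -> `|h x| <= e.
  by move=> Ax; apply: hA0; apply: le_trans Ax; rewrite /A le_max lexx.
have [d d0 hd] := heine (- A - 2) (A + 2) ch e0.
(* With a mesh of at most d / 2, consecutive nodes are less than d apart; with a mesh
   of at most 1, the nodes stay in [- A - 2, A + 2]. *)
pose d' := Num.min (d / 2) 1.
have d'0 : 0 < d' by rewrite /d' lt_min ltr01 divr_gt0.
pose m := (Num.bound ((2 * A + 1) / d')).+1.
pose r := (2 * A + 1) / m%:R.
have r0 : 0 < r by rewrite divr_gt0//; lra.
have rd' : r <= d'.
  rewrite /r ler_pdivrMr// [leRHS]mulrC -ler_pdivrMr//.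
  have q0 : 0 <= (2 * A + 1) / d' by rewrite divr_ge0 ?(ltW d'0)//; lra.
  by rewrite (le_trans (ltW (archi_boundP q0)))// ler_nat.
have mr : m%:R * r = 2 * A + 1 by rewrite /r mulrCA divff ?mulr1 ?pnatr_eq0.
have /choice[y yP] : forall i : nat, exists y : R,
    (- A - 1 + i%:R * r < y < - A - 1 + i.+1%:R * r) /\ ~ D y.
  move=> i; have [|y y1 y2] := @countable_avoid D (- A - 1 + i%:R * r)
    (- A - 1 + i.+1%:R * r) cD.
    by rewrite ltrD2l ltr_pM2r// ltr_nat.
  by exists y.
have yn i : y i <= y i.+1.
  have [/andP[_ y1] _] := yP i; have [/andP[y2 _] _] := yP i.+1.
  by rewrite ltW// (lt_trans y1).
have ynd i j : (i <= j)%N -> y i <= y j.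
  move=> ij; rewrite -(subnKC ij); elim: (j - i)%N => [|k IHk]; first by rewrite addn0.
  by rewrite addnS (le_trans IHk).
have y0A : y 0%N < - A.
  have [/andP[_]] := yP 0%N; rewrite mul1r => y1 _.
  have : d' <= 1 by rewrite /d' ge_min lexx orbT.
  lra.
have ymA : A < y m.
  have [/andP[+ _] _] := yP m; rewrite mr; lra.
exists m, y, (fun i => h (y i)); split => //.
  by move=> i; have [] := yP i.
move=> x; have [xy0|xy0] := leP x (y 0%N).
  rewrite /stepfun big1 ?subr0 => [|i _].
    by apply: hA; rewrite ler0_norm; lra.
  rewrite indicE memNset ?mulr0//= in_itv/= => /andP[yx _].
  by have := ynd _ _ (leq0n i); lra.
have [yx|yx] := ltP (y m) x.
  rewrite /stepfun big1 ?subr0 => [|i _].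
    by apply: hA; rewrite ger0_norm; lra.
  rewrite indicE memNset ?mulr0//= in_itv/= => /andP[_ xy].
  have := ynd _ _ (ltn_ord i); lra.
have [i im /andP[yix xyi]] : exists2 i, (i < m)%N & y i < x <= y i.+1.
  move: yx; elim: (m) => [|k IHk]; first by rewrite leNgt xy0.
  have [xk _|kx xk1] := leP x (y k).
    by have [j jk jx] := IHk xk; exists j => //; rewrite ltnS ltnW.
  by exists k => //; rewrite kx.
rewrite /stepfun (bigD1 (Ordinal im))//= big1 ?addr0 => [|j ji].
  rewrite indicE mem_set/= ?in_itv/= ?yix// mulr1 distrC.
  have [/andP[y1 y2] _] := yP i; have [/andP[y3 y4] _] := yP i.+1.
  have dd : d' <= d / 2 by rewrite /d' ge_min lexx.
  move: y2 y4; rewrite -!natr1 => y2 y4.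
  apply: hd.
    have := ynd _ _ (leq0n i); have := ynd _ _ (ltnW im).
    have [/andP[y5 _] _] := yP 0%N; move: y5; rewrite mul0r.
    have [/andP[_ y6] _] := yP m; move: y6; rewrite -natr1 mulrDl mr.
    have : d' <= 1 by rewrite /d' ge_min lexx orbT.
    lra.
  rewrite ltr_norml; lra.
rewrite indicE memNset ?mulr0//= in_itv/= => /andP[yjx xyj].
have [ij|ij|ij] := ltngtP i j.
- have := ynd _ _ ij; lra.
- have := ynd _ _ ij; lra.
- by move: ji; rewrite -val_eqE/= ij eqxx.
Qed.

Lemma int_stepfun mu m (y c : nat -> R) : (mu setT < +oo)%E ->
  bounded_measurable (stepfun m y c) /\
  \int[mu]_x stepfun m y c x = \sum_(i < m) c i * fine (mu `]y i, y i.+1]%classic).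
Proof.
move=> fmu; elim: m => [|m [bm IH]].
  have -> : stepfun 0 y c = cst 0 by apply/funext => x; rewrite /stepfun big_ord0.
  split; first by split; [exact: measurable_cst|exists 0 => x; rewrite normr0].
  by rewrite big_ord0 Rintegral_cst// mul0r.
have -> : stepfun m.+1 y c =
    fun x => stepfun m y c x + c m * \1_(`]y m, y m.+1]%classic) x.
  by apply/funext => x; rewrite /stepfun big_ord_recr.
have b1 : bounded_measurable (\1_(`]y m, y m.+1]%classic) : R -> R).
  split; first by apply: measurable_indic; exact: measurable_itv.
  by exists 1 => x; rewrite indicE ger0_norm// lern1 leq_b1.
have b2 : bounded_measurable (fun x => c m * \1_(`]y m, y m.+1]%classic) x).
  case: b1 => mb [C hC]; split; first exact: measurable_funM.
  by exists (`|c m| * C) => x; rewrite normrM ler_wpM2l.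
split.
  case: bm => m1 [C1 h1]; case: b2 => m2 [C2 h2].
  split; first exact: measurable_funD.
  by exists (C1 + C2) => x; rewrite (le_trans (ler_normD _ _))// lerD.
rewrite RintegralD//; try exact: bounded_measurable_integrable.
rewrite IH big_ord_recr/=; congr (_ + _).
rewrite RintegralZl//; last exact: bounded_measurable_integrable.
congr (_ * _); rewrite /Rintegral integral_indic ?setIT//.
Qed.

End vague.

(** * Vague convergence of differences of finite measures *)

Section vague_cvg.
Context {R : realType}.
Local Notation Meas := {measure set (measurableTypeR R) -> \bar R}.
Implicit Types (P N : Meas) (h : R -> R).

(** The integral of [h] against the signed measure P - N.  Keeping the two measures
  apart allows any decomposition, not only the Jordan one, to bound the variation. *)
Definition int_diff P N h : R := \int[P]_x h x - \int[N]_x h x.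

Lemma lee_lty P (M : R) : (P setT <= M%:E)%E -> (P setT < +oo)%E.
Proof. by move=> h; rewrite (le_lt_trans h)// ltry. Qed.

Lemma le_int P h (C M : R) : (P setT <= M%:E)%E -> 0 <= C ->
  measurable_fun [set: measurableTypeR R] h -> (forall x, `|h x| <= C) ->
  `|\int[P]_x h x| <= C * M.
Proof.
move=> PM C0 mh hC; rewrite (le_trans (le_normr_int (lee_lty PM) mh hC))//.
rewrite ler_wpM2l// -lee_fin fineK// fin_num_abs gee0_abs//; exact: lee_lty PM.
Qed.

Lemma bounded_measurableB h g : bounded_measurable h -> bounded_measurable g -> bounded_measurable (fun x => h x - g x).
Proof.
move=> [mh [C hC]] [mg [E gE]]; split; first exact: measurable_funB.
by exists (C + E) => x; rewrite (le_trans (ler_normB _ _))// lerD.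
Qed.

Lemma bounded_measurableZ (c : R) h : bounded_measurable h -> bounded_measurable (fun x => c * h x).
Proof.
move=> [mh [C hC]]; split; first exact: measurable_funM.
by exists (`|c| * C) => x; rewrite normrM ler_wpM2l.
Qed.

Lemma int_diffB P N h g : (P setT < +oo)%E -> (N setT < +oo)%E -> bounded_measurable h -> bounded_measurable g ->
  int_diff P N (fun x => h x - g x) = int_diff P N h - int_diff P N g.
Proof.
move=> fP fN bh bg; rewrite /int_diff !RintegralB//; try exact: bounded_measurable_integrable.
lra.
Qed.

Lemma int_diffZ P N (c : R) h : (P setT < +oo)%E -> (N setT < +oo)%E -> bounded_measurable h ->
  int_diff P N (fun x => c * h x) = c * int_diff P N h.
Proof.
move=> fP fN bh; rewrite /int_diff !RintegralZl//; try exact: bounded_measurable_integrable.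
by rewrite mulrBr.
Qed.

Lemma le_int_diff P N h (C M : R) : (P setT <= M%:E)%E -> (N setT <= M%:E)%E -> 0 <= C ->
  measurable_fun [set: measurableTypeR R] h -> (forall x, `|h x| <= C) ->
  `|int_diff P N h| <= 2 * (C * M).
Proof.
move=> PM NM C0 mh hC; rewrite (le_trans (ler_normB _ _))//.
have := le_int PM C0 mh hC; have := le_int NM C0 mh hC; lra.
Qed.

Lemma vanishing_bounded_measurable h : continuous h -> vanishing h -> bounded_measurable h.
Proof.
move=> ch vh; split; first exact: continuous_measurable_fun.
have [A hA] := vh 1 ltr01.
have [d d0 hd] := heine (- `|A|) `|A| ch ltr01.
have cK : {within `[- `|A|, `|A|], continuous (fun x => `|h x|)}.
  apply: continuous_subspaceT => x; apply: continuous_comp; first exact: ch.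
  exact: norm_continuous.
have AA : - `|A| <= `|A| by rewrite ge0_cp.
have [c _ hc] := EVT_max AA cK.
exists (Num.max `|h c| 1) => x; rewrite le_max.
have [Ax|xA] := leP `|A| `|x|.
  by rewrite (hA x) ?orbT// (le_trans (ler_norm A)).
by rewrite hc// in_itv/= -ler_norml ltW.
Qed.

Let eps_budget (e M : R) : 0 < e -> 0 <= M ->
  exists2 e', 0 < e' & 2 * (e' * M) <= e / 3.
Proof.
move=> e0 M0; exists (e / (6 * (M + 1))); first by rewrite divr_gt0//; lra.
have -> : 2 * (e / (6 * (M + 1)) * M) = (e / 3) * (M / (M + 1)) by field; lra.
by rewrite ger_pMr ?divr_gt0// ler_pdivrMr; lra.
Qed.

(** The convergence holds for step functions with nodes outside [D], and these are
  uniformly close to [h], hence close for the integrals as the masses are bounded. *)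
Lemma vague_cvg (P_ N_ : nat -> Meas) P N (M : R) (D : set R) h :
  (forall n, P_ n setT <= M%:E)%E -> (forall n, N_ n setT <= M%:E)%E ->
  (P setT <= M%:E)%E -> (N setT <= M%:E)%E -> countable D ->
  (forall a b, ~ D a -> ~ D b -> a <= b ->
    fine (P_ n `]a, b]%classic) - fine (N_ n `]a, b]%classic) @[n --> \oo] -->
    fine (P `]a, b]%classic) - fine (N `]a, b]%classic)) ->
  continuous h -> vanishing h ->
  int_diff (P_ n) (N_ n) h @[n --> \oo] --> int_diff P N h.
Proof.
move=> P_M N_M PM NM cD PN ch vh; apply/cvgrPdist_le => e e0.
have M0 : 0 <= M by rewrite -lee_fin (le_trans _ PM).
have [e' e'0 e'M] := eps_budget e0 M0.
have bh := vanishing_bounded_measurable ch vh.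
have [m [y [c [Dy yn hg]]]] := step_approx cD ch vh e'0.
have fin (Q : Meas) : (Q setT <= M%:E)%E -> (Q setT < +oo)%E by exact: lee_lty.
have bg : bounded_measurable (stepfun m y c) by have [] := int_stepfun m y c (fin _ PM).
have approx (Q Q' : Meas) : (Q setT <= M%:E)%E -> (Q' setT <= M%:E)%E ->
    `|int_diff Q Q' h - int_diff Q Q' (stepfun m y c)| <= e / 3.
  move=> QM Q'M; rewrite -int_diffB//; try exact: fin.
  rewrite (le_trans _ e'M)// le_int_diff//; first exact: ltW.
  by case: bh bg => [mh _] [mg _]; exact: measurable_funB.
have : int_diff (P_ n) (N_ n) (stepfun m y c) @[n --> \oo] -->
       int_diff P N (stepfun m y c).
  have E (Q Q' : Meas) : (Q setT <= M%:E)%E -> (Q' setT <= M%:E)%E ->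
      int_diff Q Q' (stepfun m y c) = \sum_(i < m)
        c i * (fine (Q `]y i, y i.+1]%classic) - fine (Q' `]y i, y i.+1]%classic)).
    move=> QM Q'M; rewrite /int_diff.
    have [_ ->] := int_stepfun m y c (fin _ QM).
    have [_ ->] := int_stepfun m y c (fin _ Q'M).
    by rewrite -sumrB; apply: eq_bigr => i _; rewrite mulrBr.
  rewrite E//; under eq_fun do rewrite E//.
    by apply: cvg_big => [|i _]; [exact: add_continuous|apply: cvgMl_tmp; exact: PN].
have e3 : 0 < e / 3 by rewrite divr_gt0.
move=> /cvgrPdist_le/(_ _ e3); apply: filterS => n hn.
have := approx _ _ PM NM; have := approx _ _ (P_M n) (N_M n); move: hn.
rewrite !ler_norml => /andP[h1 h2] /andP[h3 h4] /andP[h5 h6].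
by apply/andP; clear -h1 h2 h3 h4 h5 h6; split; lra.
Qed.

End vague_cvg.

(** * Averaging over a window of the parameter *)

Section smoothing.
Context {R : realType}.
Local Notation Meas := {measure set (measurableTypeR R) -> \bar R}.
Implicit Types (P N : Meas) (k K : R -> R -> R).

(** [k t x] is a function of [x] depending on a parameter [t], and [K] a primitive of
  [k] in [t]; the conditions are those under which integration in [x] commutes with
  differentiation in [t]. *)
Record diff_kernel k K : Prop := Kernel {
  kernel_derive : forall x t : R, is_derive t 1 (K ^~ x) (k t x) ;
  kernel_cont : forall x : R, continuous (k ^~ x) ;
  kernel_meas : forall t, measurable_fun [set: measurableTypeR R] (k t) ;
  kernel_prim : forall t, bounded_measurable (K t) ;
  kernel_locb : forall T : R, exists C, forall t x, `|t| <= T -> `|k t x| <= C }.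

Section one_kernel.
Variables k K : R -> R -> R.
Hypothesis kK : diff_kernel k K.

Lemma kernel_bounded_measurable t : bounded_measurable (k t).
Proof.
split; first exact: (kernel_meas kK).
by have [C hC] := kernel_locb kK `|t|; exists C => x; apply: hC.
Qed.

Let in_window (t s : R) : t - 1 < s < t + 1 -> `|s| <= `|t| + 1.
Proof.
move=> ts; rewrite -(subrK t s) addrC (le_trans (ler_normD _ _))// lerD2l.
by rewrite ler_norml; lra.
Qed.

Let Rint_derive P (t : R) : (P setT < +oo)%E ->
  is_derive t 1 (fun s => \int[P]_x K s x) (\int[P]_x k t x).
Proof.
move=> fP.
have It : `]t - 1, t + 1[%classic t by rewrite /= in_itv/=; lra.
have intK s : `]t - 1, t + 1[%classic s -> P.-integrable setT (EFin \o K s).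
  by move=> _; apply: bounded_measurable_integrable => //; exact: (kernel_prim kK).
have derK s x : `]t - 1, t + 1[%classic s -> setT x -> derivable (K ^~ x) s 1.
  by move=> _ _; case: (kernel_derive kK x s).
have [C hC] := kernel_locb kK (`|t| + 1).
have C0 (x : measurableTypeR R) : 0 <= `|C| by [].
have iC : P.-integrable setT (EFin \o (fun _ : measurableTypeR R => `|C|)).
  by apply: bounded_measurable_integrable => //; split; [exact: measurable_cst|exists `|C| => _; rewrite normr_id].
have dE s x : partial1of2 K s x = k s x.
  by rewrite partial1of2E; have [_] := kernel_derive kK x s.
have ub s x : `]t - 1, t + 1[%classic s -> setT x -> `|partial1of2 K s x| <= `|C|.
  rewrite /= in_itv/= => ts _; rewrite dE (le_trans (hC _ _ (in_window ts)))//.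
  exact: ler_norm.
have dv := @derivable_under_integral R _ _ P K setT measurableT t (t - 1) (t + 1)
  It intK derK _ C0 iC ub.
have df := @differentiation_under_integral R _ _ P K setT measurableT t (t - 1) (t + 1)
  It intK derK _ C0 iC ub.
have -> : \int[P]_x k t x = \int[P]_x partial1of2 K t x.
  by apply: eq_Rintegral => x _; rewrite dE.
by rewrite -df derive1E; apply: DeriveDef.
Qed.

Let Rint_continuous P : (P setT < +oo)%E ->
  continuous (fun s => \int[P]_x k s x).
Proof.
move=> fP t.
have It : t \in `]t - 1, t + 1[%classic by rewrite inE /= in_itv/=; lra.
have [C hC] := kernel_locb kK (`|t| + 1).
apply: (@continuity_under_integral R _ _ P k setT measurableT (t - 1) (t + 1)
  _ _ (fun _ => C) _ _ t It).
- by move=> s _; apply: bounded_measurable_integrable => //; exact: kernel_bounded_measurable.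
- by apply: aeW => x _ s _; exact: (kernel_cont kK).
- by apply: bounded_measurable_integrable => //; split; [exact: measurable_cst|exists `|C|].
- by move=> s; rewrite /= in_itv/= => ts; apply: aeW => x _; apply: hC (in_window ts).
Qed.

Lemma int_diff_continuous P N : (P setT < +oo)%E -> (N setT < +oo)%E ->
  continuous (fun s => int_diff P N (k s)).
Proof. by move=> fP fN t; apply: cvgB; exact: Rint_continuous. Qed.

Lemma int_diff_derive P N (t : R) : (P setT < +oo)%E -> (N setT < +oo)%E ->
  is_derive t 1 (fun s => int_diff P N (K s)) (int_diff P N (k t)).
Proof.
move=> fP fN; have := Rint_derive t fP; have := Rint_derive t fN => dN dP.
exact: is_deriveB.
Qed.

(** Up to the factor 2 d, the mean of the kernel over the parameters in
  [t - d, t + d]. *)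
Definition window (K : R -> R -> R) (d t : R) : R -> R := fun x => K (t + d) x - K (t - d) x.

Lemma window_bounded_measurable (d t : R) : bounded_measurable (window K d t).
Proof. by apply: bounded_measurableB; exact: (kernel_prim kK). Qed.

(** Mean value theorem for the integral of the primitive: a window average of the
  integral is its value at some parameter of the window. *)
Lemma int_diff_window P N (d t : R) : (P setT < +oo)%E -> (N setT < +oo)%E -> 0 < d ->
  exists2 s, `|s - t| <= d & int_diff P N (window K d t) = 2 * d * int_diff P N (k s).
Proof.
move=> fP fN d0.
have td : t - d <= t + d by lra.
have cK : {within `[t - d, t + d], continuous (fun s => int_diff P N (K s))}.
  apply: continuous_subspaceT => s.
  apply/differentiable_continuous/derivable1_diffP.
  by case: (int_diff_derive s fP fN).
have [s] := MVT_segment td (fun s _ => int_diff_derive s fP fN) cK.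
rewrite in_itv/= => ts hs; exists s; first by rewrite ler_norml; lra.
rewrite /window int_diffB//; try exact: (kernel_prim kK).
by rewrite hs; ring.
Qed.

End one_kernel.

(** Equicontinuity of the tail of the sequence, which is what a limit along n provides. *)
Definition equicont_at (f_ : nat -> R -> R) (t : R) :=
  forall e : R, 0 < e -> exists2 d, 0 < d &
    \forall n \near \oo, forall b, `|b - t| <= d -> `|f_ n b - f_ n t| <= e.

(** The function [g] below is continuous and vanishes at infinity, so its integrals
  converge.  By the mean value theorem they are values of the integral of the kernel
  near [t], up to [kap] times values near [t0], which are small since the integral is 0
  at [t0] itself.  Equicontinuity makes the error uniform in n. *)
Lemma kernel_cvg k K (kK : diff_kernel k K) (t t0 kap : R)
  (P_ N_ : nat -> Meas) P N (M : R) (D : set R) :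
  (forall n, P_ n setT <= M%:E)%E -> (forall n, N_ n setT <= M%:E)%E ->
  (P setT <= M%:E)%E -> (N setT <= M%:E)%E -> countable D ->
  (forall a b, ~ D a -> ~ D b -> a <= b ->
    fine (P_ n `]a, b]%classic) - fine (N_ n `]a, b]%classic) @[n --> \oo] -->
    fine (P `]a, b]%classic) - fine (N `]a, b]%classic)) ->
  (forall x, k t0 x = 0) ->
  (forall d, 0 < d -> continuous (fun x => window K d t x - kap * window K d t0 x)) ->
  (forall d, 0 < d -> vanishing (fun x => window K d t x - kap * window K d t0 x)) ->
  equicont_at (fun n s => int_diff (P_ n) (N_ n) (k s)) t ->
  equicont_at (fun n s => int_diff (P_ n) (N_ n) (k s)) t0 ->
  int_diff (P_ n) (N_ n) (k t) @[n --> \oo] --> int_diff P N (k t).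
Proof.
move=> P_M N_M PM NM cD PN k0 cg vg eqt eqt0; apply/cvgrPdist_le => e e0.
have fin (Q : Meas) : (Q setT <= M%:E)%E -> (Q setT < +oo)%E by exact: lee_lty.
have k1 : 0 < 1 + `|kap| by rewrite ltr_pwDl.
(* The integrals of g and of the kernel differ by at most (1 + |kap|) e' = e / 4,
   both for the measures of index n and for the limits. *)
pose e' := e / (4 * (1 + `|kap|)).
have e'0 : 0 < e' by rewrite divr_gt0// mulr_gt0.
have e'E : e' + `|kap| * e' = e / 4.
  by rewrite /e'; field; rewrite gt_eqF.
have cphi := int_diff_continuous kK (fin _ PM) (fin _ NM).
have eqc s : exists2 d, 0 < d & forall b, `|b - s| <= d ->
    `|int_diff P N (k b) - int_diff P N (k s)| <= e'.
  have /cvgrPdist_le/(_ _ e'0)/nbhs_ballP[d /= d0 hd] := cphi s.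
  exists (d / 2); first by rewrite divr_gt0.
  move=> b bs; rewrite distrC; apply: hd; rewrite /ball/= distrC.
  by rewrite (le_lt_trans bs)// ltr_pdivrMr// ltr_pMr// ltr1n.
have [d1 d10 h1] := eqt _ e'0; have [d2 d20 h2] := eqt0 _ e'0.
have [d3 d30 h3] := eqc t; have [d4 d40 h4] := eqc t0.
pose d := Num.min (Num.min d1 d2) (Num.min d3 d4).
have d0 : 0 < d by rewrite /d !lt_min d10 d20 d30 d40.
have dd1 : d <= d1 by rewrite /d !ge_min lexx.
have dd2 : d <= d2 by rewrite /d !ge_min lexx orbT.
have dd3 : d <= d3 by rewrite /d !ge_min lexx !orbT.
have dd4 : d <= d4 by rewrite /d !ge_min lexx !orbT.
pose g := fun x => (2 * d)^-1 * (window K d t x - kap * window K d t0 x).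
have gE (Q Q' : Meas) : (Q setT <= M%:E)%E -> (Q' setT <= M%:E)%E ->
    (forall b, `|b - t| <= d -> `|int_diff Q Q' (k b) - int_diff Q Q' (k t)| <= e') ->
    (forall b, `|b - t0| <= d -> `|int_diff Q Q' (k b) - int_diff Q Q' (k t0)| <= e') ->
    `|int_diff Q Q' g - int_diff Q Q' (k t)| <= e / 4.
  move=> QM Q'M hb hb0.
  have bw s := window_bounded_measurable kK d s.
  rewrite /g int_diffZ//; try exact: fin; last by apply: bounded_measurableB => //; exact: bounded_measurableZ.
  rewrite int_diffB//; try exact: fin; last exact: bounded_measurableZ.
  rewrite int_diffZ//; try exact: fin.
  have [s st ->] := int_diff_window kK t (fin _ QM) (fin _ Q'M) d0.
  have [s0 st0 ->] := int_diff_window kK t0 (fin _ QM) (fin _ Q'M) d0.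
  have -> : (2 * d)^-1 * (2 * d * int_diff Q Q' (k s) - kap * (2 * d * int_diff Q Q' (k s0))) =
    int_diff Q Q' (k s) - kap * int_diff Q Q' (k s0) by field; rewrite gt_eqF.
  have z0 : int_diff Q Q' (k t0) = 0.
    have -> : k t0 = cst 0 by apply/funext.
    by rewrite /int_diff !Rintegral_cst// !mul0r subrr.
  have := hb0 _ st0; rewrite z0 subr0 => hs0.
  rewrite addrAC (le_trans (ler_normB _ _))// -e'E normrM.
  by rewrite lerD ?hb// ler_wpM2l.
have := @vague_cvg R P_ N_ P N M D g P_M N_M PM NM cD PN.
have cg' : continuous g.
  by move=> x; apply: cvgMl_tmp; exact: cg.
have vg' : vanishing g.
  move=> r r0; have [|A hA] := vg d d0 (2 * d * r); first by rewrite !mulr_gt0.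
  exists A => x Ax; rewrite /g normrM ger0_norm ?invr_ge0; last by rewrite mulr_ge0// ltW.
  by rewrite ler_pdivrMl ?mulr_gt0// hA.
have e4 : 0 < e / 4 by rewrite divr_gt0.
move=> /(_ cg' vg')/cvgrPdist_le/(_ _ e4) hg.
near=> n.
have c1 : `|int_diff P N g - int_diff P N (k t)| <= e / 4.
  apply: gE => // b bt; [apply: h3|apply: h4]; exact: le_trans bt _.
have c2 : `|int_diff (P_ n) (N_ n) g - int_diff (P_ n) (N_ n) (k t)| <= e / 4.
  apply: gE => //.
    have h : forall b, `|b - t| <= d1 ->
      `|int_diff (P_ n) (N_ n) (k b) - int_diff (P_ n) (N_ n) (k t)| <= e' by near: n.
    by move=> b bt; apply: h; exact: le_trans bt _.
  have h : forall b, `|b - t0| <= d2 ->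
    `|int_diff (P_ n) (N_ n) (k b) - int_diff (P_ n) (N_ n) (k t0)| <= e' by near: n.
  by move=> b bt; apply: h; exact: le_trans bt _.
have c3 : `|int_diff P N g - int_diff (P_ n) (N_ n) g| <= e / 4 by near: n.
move: c1 c2 c3; rewrite !ler_norml => /andP[i1 i2] /andP[i3 i4] /andP[i5 i6].
by clear -i1 i2 i3 i4 i5 i6 e0; apply/andP; split; lra.
Unshelve. all: by end_near. Qed.

End smoothing.

(** * Recovering modulus and argument from a Fourier transform *)

Section polar.
Context {R : realType}.

(** Leaving ]-pi/2, pi/2[ continuously requires a zero of the cosine. *)
Lemma cos_pos_interval (th : R -> R) (a b : R) :
  {within `[Num.min a b, Num.max a b], continuous th} -> th a = 0 ->
  (forall x, Num.min a b <= x <= Num.max a b -> 0 < cos (th x)) ->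
  - (pi / 2) < th b < pi / 2.
Proof.
move=> cth tha cpos; apply/negPn/negP => nb.
have pi0 := pi_gt0 R.
have mM : Num.min a b <= Num.max a b by rewrite ge_min le_max lexx.
have [v [vE v_btw]] : exists v, cos v = 0 /\
    Num.min (th (Num.min a b)) (th (Num.max a b)) <= v <=
    Num.max (th (Num.min a b)) (th (Num.max a b)).
  have [t1|t1] := leP (pi / 2) (th b).
    exists (pi / 2); split; first exact: cos_pihalf.
    by have [_|_] := leP a b; rewrite tha ge_min le_max; apply/andP; split;
      apply/orP; (by left; lra) || (by right; lra).
  have t2 : th b <= - (pi / 2) by move: nb; rewrite t1 andbT -leNgt.
  exists (- (pi / 2)); split; first by rewrite cosN cos_pihalf.
  by have [_|_] := leP a b; rewrite tha ge_min le_max; apply/andP; split;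
    apply/orP; (by left; lra) || (by right; lra).
have [c] := IVT mM cth v_btw; rewrite in_itv/= => cab thc.
by have := cpos c cab; rewrite thc vE ltxx.
Qed.

Lemma abs_atan_le (y : R) : `|atan y| <= `|y|.
Proof.
wlog y0 : y / 0 <= y.
  move=> h; have [y0|y0] := leP 0 y; first exact: h.
  by rewrite -normrN -atanN -[leRHS]normrN h//; lra.
have a0 : 0 <= atan y by rewrite -(atan0 R) le_atan.
rewrite !ger0_norm// -subr_ge0.
apply: (@ge0_of_deriv_ge0 R (fun x => x - atan x) (fun x => 1 - (1 + x ^+ 2)^-1)) => //.
  by rewrite atan0 subrr.
move=> x _; rewrite subr_ge0 invf_le1 ?lerDl ?sqr_ge0//.
by rewrite ltr_pwDl// sqr_ge0.
Qed.

(** With [X] and [Y] the real and imaginary parts of the quotient of the values at [b]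
  and [t], the hypothesis says that X + iY is close to 1.  As X > 0 on the whole window,
  the argument never leaves ]-pi/2, pi/2[, so it equals atan (Y / X); the modulus is
  the square root of X^2 + Y^2. *)
Lemma polar_lift (c s : R -> R) (t B d eta e : R) :
  continuous s -> `|c t| <= B -> 0 <= e <= 2^-1 ->
  2 * (eta * expR B) <= e ->
  (forall b, `|b - t| <= d ->
    `|expR (c b) * cos (s b) - expR (c t) * cos (s t)| <= eta /\
    `|expR (c b) * sin (s b) - expR (c t) * sin (s t)| <= eta) ->
  forall b, `|b - t| <= d -> `|c b - c t| <= 2 * e /\ `|s b - s t| <= 2 * e.
Proof.
move=> cs cB /andP[e0 e2] etae near_t.
pose X b := expR (c b - c t) * cos (s b - s t).
pose Y b := expR (c b - c t) * sin (s b - s t).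
have XY b : `|b - t| <= d -> `|X b - 1| <= e /\ `|Y b| <= e.
  move=> bt; have [h1 h2] := near_t b bt.
  have eta0 : 0 <= eta by exact: le_trans h1.
  (* The modulus at t is at least exp (- B), hence the factor exp B. *)
  have Ec : expR (c b) = expR (c t) * expR (c b - c t) by rewrite -expRD addrC subrK.
  set u := expR (c t) in h1 h2 Ec *.
  have u0 : 0 < u by exact: expR_gt0.
  have uB : u^-1 <= expR B.
    by rewrite -expRN ler_expR; move: cB; rewrite ler_norml; lra.
  have C1 := cos2Dsin2 (s t).
  set x1 := expR (c b) * cos (s b) - u * cos (s t) in h1.
  set x2 := expR (c b) * sin (s b) - u * sin (s t) in h2.
  have cst1 := cos_max (s t); have sst1 := sin_max (s t).
  have bnd (p q : R) : `|p| <= 1 -> `|q| <= 1 -> `|u^-1 * (x1 * p + x2 * q)| <= e.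
    move=> p1 q1; apply: le_trans etae.
    rewrite normrM (ger0_norm (ltW _)) ?invr_gt0//.
    have h3 : `|x1 * p + x2 * q| <= 2 * eta.
      rewrite (le_trans (ler_normD _ _))// !normrM.
      have : `|x1| * `|p| <= eta * 1 by rewrite ler_pM.
      have : `|x2| * `|q| <= eta * 1 by rewrite ler_pM.
      lra.
    rewrite (le_trans (ler_wpM2l _ h3)) ?invr_ge0 ?(ltW u0)//.
    have := ler_wpM2l eta0 uB; lra.
  have un0 : u != 0 by rewrite gt_eqF.
  split.
    have -> : X b - 1 = u^-1 * (x1 * cos (s t) + x2 * sin (s t)).
      rewrite /X cosB /x1 /x2 Ec -C1.
      have -> : expR (c b - c t) = u^-1 * (u * expR (c b - c t)) by rewrite mulrA mulVf ?mul1r.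
      set w := u * expR _; field; exact: un0.
    exact: bnd.
  have -> : Y b = u^-1 * (x1 * - sin (s t) + x2 * cos (s t)).
    rewrite /Y sinB /x1 /x2 Ec.
    set w := expR (c b - c t); field; exact: un0.
  by apply: bnd => //; rewrite normrN.
have Xpos b : `|b - t| <= d -> 0 < cos (s b - s t).
  move=> bt; have [+ _] := XY b bt; rewrite ler_norml => /andP[X1 _].
  by rewrite -(pmulr_rgt0 _ (expR_gt0 (c b - c t))) -/(X b); lra.
move=> b bt; have [X1 Y1] := XY b bt.
have Xgt0 : 2^-1 <= X b by move: X1; rewrite ler_norml => /andP[]; lra.
have XYsq : X b ^+ 2 + Y b ^+ 2 = expR (c b - c t) ^+ 2.
  by rewrite /X /Y !exprMn -mulrDr cos2Dsin2 mulr1.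
have e2' : e * e <= e / 2 by rewrite ler_wpM2l.
set w := expR (c b - c t) in XYsq.
have w0 : 0 < w by exact: expR_gt0.
have wup : w <= 1 + 2 * e.
  rewrite -(@ler_pXn2r _ 2) ?nnegrE ?(ltW w0)//; last by lra.
  rewrite -XYsq; move: X1 Y1; rewrite !ler_norml => /andP[X1 X2] /andP[Y1 Y2].
  have : X b ^+ 2 <= (1 + e) ^+ 2 by rewrite ler_pXn2r ?nnegrE//; lra.
  have : Y b ^+ 2 <= e ^+ 2.
    by rewrite -(real_normK (num_real (Y b))) ler_pXn2r ?nnegrE// ler_norml Y1.
  have := mulr_ge0 e0 e0; rewrite !expr2; lra.
have wlo : 1 - e <= w.
  rewrite -(@ler_pXn2r _ 2) ?nnegrE ?(ltW w0)//; last by lra.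
  rewrite -XYsq; move: X1; rewrite !ler_norml => /andP[X1 X2].
  have : (1 - e) ^+ 2 <= X b ^+ 2 by rewrite ler_pXn2r ?nnegrE//; lra.
  have := sqr_ge0 (Y b); lra.
split.
  rewrite ler_norml; apply/andP; split.
    rewrite lerNl -ler_expR expRN -/w.
    apply: (@le_trans _ _ (1 + 2 * e)); last exact: expR_ge1Dx.
    rewrite -[leLHS]mul1r ler_pdivrMr//.
    have : (1 + 2 * e) * (1 - e) <= (1 + 2 * e) * w by rewrite ler_wpM2l//; lra.
    lra.
  by rewrite -ler_expR -/w (le_trans wup)// expR_ge1Dx.
have th_range : - (pi / 2) < s b - s t < pi / 2.
  apply: (@cos_pos_interval (fun x => s x - s t) t b); last first.
  - move=> x xtb; apply: Xpos; apply: le_trans bt.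
    move: xtb; have [tb|bt'] := leP t b => /andP[x1 x2].
      by rewrite !ger0_norm; lra.
    by rewrite !ler0_norm; lra.
  - exact: subrr.
  - by apply: continuous_subspaceT => x; apply: cvgB; [exact: cs|exact: cvg_cst].
have -> : s b - s t = atan (Y b / X b).
  rewrite -[LHS](@tanK R); last by rewrite in_itv.
  congr atan; rewrite /tan /Y /X -mulf_div divff ?mul1r//.
  by rewrite gt_eqF// expR_gt0.
rewrite (le_trans (abs_atan_le _))// normrM normfV ler_pdivrMr; last first.
  by rewrite normr_gt0 gt_eqF//; lra.
rewrite (ger0_norm (_ : 0 <= X b)); last by lra.
rewrite (le_trans Y1)//.
have : e * 1 <= e * (2 * X b) by rewrite ler_wpM2l//; lra.
lra.
Qed.

(** The bound on [c_] at [t] keeps the modulus of the functions away from 0, without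
  which small variations could turn the argument arbitrarily. *)
Lemma equicont_polar (c_ s_ : nat -> R -> R) (t B : R) :
  (forall n, continuous (s_ n)) -> (\forall n \near \oo, `|c_ n t| <= B) ->
  equicont_at (fun n b => expR (c_ n b) * cos (s_ n b)) t ->
  equicont_at (fun n b => expR (c_ n b) * sin (s_ n b)) t ->
  equicont_at c_ t /\ equicont_at s_ t.
Proof.
move=> cs cB ecos esin.
have main e : 0 < e -> exists2 d, 0 < d & \forall n \near \oo, forall b,
    `|b - t| <= d -> `|c_ n b - c_ n t| <= e /\ `|s_ n b - s_ n t| <= e.
  move=> e0; pose e' := Num.min (e / 2) (2^-1).
  have e'0 : 0 < e' by rewrite /e' lt_min divr_gt0//= invr_gt0.
  have e'e : 2 * e' <= e by have : e' <= e / 2; [rewrite /e' ge_min lexx|lra].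
  have e'2 : e' <= 2^-1 by rewrite /e' ge_min lexx orbT.
  pose eta := e' / (2 * expR B).
  have eta0 : 0 < eta by rewrite divr_gt0// mulr_gt0// expR_gt0.
  have etaE : 2 * (eta * expR B) <= e'.
    by rewrite le_eqVlt; apply/orP; left; apply/eqP; rewrite /eta; field; rewrite gt_eqF// expR_gt0.
  have [d1 d10 h1] := ecos _ eta0; have [d2 d20 h2] := esin _ eta0.
  exists (Num.min d1 d2); first by rewrite lt_min d10.
  near=> n => b bt.
  have ee : 0 <= e' <= 2^-1 by rewrite (ltW e'0).
  have cBn : `|c_ n t| <= B by near: n.
  have h1n : forall b, `|b - t| <= d1 -> `|expR (c_ n b) * cos (s_ n b) -
    expR (c_ n t) * cos (s_ n t)| <= eta by near: n.
  have h2n : forall b, `|b - t| <= d2 -> `|expR (c_ n b) * sin (s_ n b) -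
    expR (c_ n t) * sin (s_ n t)| <= eta by near: n.
  have [|i1 i2] := polar_lift (cs n) cBn ee etaE _ bt.
    by move=> b'; rewrite le_min => /andP[b1 b2]; split; [exact: h1n|exact: h2n].
  by split; [exact: le_trans i1 _|exact: le_trans i2 _].
split=> e e0; have [d d0 h] := main e e0; exists d => //; apply: filterS h => n h b bt;
  by have [] := h b bt.
Unshelve. all: by end_near. Qed.

End polar.

(** * The real and imaginary parts of the Levy-Khinchine kernel *)

Section kernels.
Context {R : realType}.
Implicit Types (t x d tau : R).

(** The density that turns dG into the Levy measure, away from the origin. *)
Definition LKweight x : R := (1 + x ^+ 2) / x ^+ 2.

Definition LKcos t x := if x == 0 then - (t ^+ 2 / 2) else (cos (t * x) - 1) * LKweight x.
(** Primitive of [LKcos] in [t] that vanishes at [t = 0]; likewise for [LKsin_prim] below. *)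
Definition LKcos_prim t x := if x == 0 then - (t ^+ 3 / 6) else (sin (t * x) / x - t) * LKweight x.
Definition LKsin tau t x :=
  if x == 0 then 0 else (sin (t * x) - t / tau * sin (tau * x)) * LKweight x.
Definition LKsin_prim tau t x := if x == 0 then 0 else
  ((1 - cos (t * x)) / x - t ^+ 2 / (2 * tau) * sin (tau * x)) * LKweight x.
(** The usual cardinal sine of d x multiplied by d, as [window] is not divided by its
  length either. *)
Definition sinc d x := if x == 0 then d else sin (d * x) / x.

(** The kernels are defined by a separate clause at 0, the only point where continuity
  needs an estimate. *)
Definition cont_off0 (f : R -> R) := forall x, x != 0 -> {for x, continuous f}.

Lemma cont_off0_if (c : R) (f : R -> R) : cont_off0 f ->
  cont_off0 (fun x => if x == 0 then c else f x).
Proof.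
move=> cf x x0; rewrite /prop_for /continuous_at (negbTE x0).
apply: cvg_trans (cf x x0); apply: near_eq_cvg; near=> z.
suff -> : (z == 0) = false by [].
apply/negbTE; near: z.
by have /open_nbhs_nbhs := conj (@open_neq R 0) x0; apply.
Unshelve. all: by end_near. Qed.

Lemma cont_off0_measurable (f : R -> R) : cont_off0 f ->
  measurable_fun [set: measurableTypeR R] f.
Proof.
move=> cf.
have -> : [set: measurableTypeR R] = [set 0 : R] `|` ~` [set 0 : R] by rewrite setUv.
apply/measurable_funU => //; first exact: measurableC.
split; first exact: measurable_fun_set1.
apply: open_continuous_measurable_fun.
  by apply: closed_openC; exact: closed_eq.
by move=> x; rewrite inE /= => /eqP; exact: cf.
Qed.

Lemma cont_of_bound (f : R -> R) (C : R) : cont_off0 f ->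
  (forall x, `|x| <= 1 -> `|f x - f 0| <= C * `|x|) -> continuous f.
Proof.
move=> cf fC x; have [->|] := eqVneq x 0; last exact: cf.
apply/cvgrPdist_le => e e0.
have C0 : 0 <= C by have := fC 1; rewrite normr1 mulr1 => /(_ (lexx _)); exact: le_trans.
have eC : 0 < e / (C + 1) by rewrite divr_gt0// ltr_wpDl.
have n1 : \forall z \near (0 : R), `|z| <= 1 by exact: nbhs0_le.
have n2 : \forall z \near (0 : R), `|z| <= e / (C + 1) by exact: nbhs0_le.
apply: filterS2 n1 n2 => z z1 z2.
rewrite distrC (le_trans (fC z z1))//.
apply: (@le_trans _ _ ((C + 1) * `|z|)); first by rewrite ler_wpM2r// lerDl.
by rewrite mulrC -ler_pdivlMr// ltr_wpDl.
Qed.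

Lemma cont_off0_weight : cont_off0 LKweight.
Proof.
move=> x x0; rewrite /prop_for /continuous_at /LKweight.
apply: cvgM; first by apply: cvgD; [exact: cvg_cst|exact: exprn_continuous].
by apply: cvgV; [rewrite expf_neq0|exact: exprn_continuous].
Qed.

Lemma cont_sin_lin t : continuous (fun x => sin (t * x)).
Proof.
by move=> x; apply: continuous_comp; [exact: mulrl_continuous|exact: continuous_sin].
Qed.

Lemma cont_cos_lin t : continuous (fun x => cos (t * x)).
Proof.
by move=> x; apply: continuous_comp; [exact: mulrl_continuous|exact: continuous_cos].
Qed.

Lemma LKcos_cont_off0 t : cont_off0 (LKcos t).
Proof.
apply: cont_off0_if => x x0; apply: cvgM; last exact: cont_off0_weight.
by apply: cvgB; [exact: cont_cos_lin|exact: cvg_cst].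
Qed.

Lemma LKcos_prim_cont_off0 t : cont_off0 (LKcos_prim t).
Proof.
apply: cont_off0_if => x x0; apply: cvgM; last exact: cont_off0_weight.
apply: cvgB; last exact: cvg_cst.
by apply: cvgM; [exact: cont_sin_lin|apply: cvgV => //; exact: cvg_id].
Qed.

Lemma LKsin_cont_off0 tau t : cont_off0 (LKsin tau t).
Proof.
apply: cont_off0_if => x x0; apply: cvgM; last exact: cont_off0_weight.
by apply: cvgB; [|apply: cvgMl_tmp]; exact: cont_sin_lin.
Qed.

Lemma LKsin_prim_cont_off0 tau t : cont_off0 (LKsin_prim tau t).
Proof.
apply: cont_off0_if => x x0; apply: cvgM; last exact: cont_off0_weight.
apply: cvgB; last by apply: cvgMl_tmp; exact: cont_sin_lin.
apply: cvgM; last by apply: cvgV => //; exact: cvg_id.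
by apply: cvgB; [exact: cvg_cst|exact: cont_cos_lin].
Qed.

Lemma sinc_cont_off0 d : cont_off0 (sinc d).
Proof.
apply: cont_off0_if => x x0.
by apply: cvgM; [exact: cont_sin_lin|apply: cvgV => //; exact: cvg_id].
Qed.

Lemma weightE x : x != 0 -> LKweight x = 1 + (x ^+ 2)^-1.
Proof. by move=> x0; rewrite /LKweight; field. Qed.

Lemma weight_gt0 x : x != 0 -> 0 < LKweight x.
Proof.
by move=> x0; rewrite weightE// ltr_wpDr// invr_ge0 sqr_ge0.
Qed.

(** The weight is 1 + 1 / x^2: the bound [C] serves for the first term, [C'] for the
  second. *)
Lemma weighted_bound x (y C C' : R) : x != 0 -> `|y| <= C -> `|y| <= C' * x ^+ 2 ->
  `|y * LKweight x| <= C + C'.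
Proof.
move=> x0 yC yC'; have x2 : 0 < x ^+ 2 by rewrite exprn_even_gt0.
rewrite normrM (gtr0_norm (weight_gt0 x0)) weightE// mulrDr mulr1 lerD//.
by rewrite ler_pdivrMr.
Qed.

Lemma LKcos_bound t x : `|LKcos t x| <= 2 + t ^+ 2 / 2.
Proof.
rewrite /LKcos; have t0 := sqr_ge0 t; case: eqVneq => [_|x0].
  by rewrite normrN ger0_norm; lra.
have := one_sub_cos_bounds (t * x) => /andP[_]; rewrite exprMn => h.
have c1 := cos_le1 (t * x).
have := cos_geN1 (t * x) => c2.
by apply: weighted_bound => //; rewrite distrC ger0_norm; lra.
Qed.

(** The linear terms of the two sines cancel. *)
Lemma sin_comb_sq tau t x : 0 < tau ->
  `|sin (t * x) - t / tau * sin (tau * x)| <= (t ^+ 2 + `|t| * tau) * x ^+ 2.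
Proof.
move=> tau0.
have -> : sin (t * x) - t / tau * sin (tau * x) =
  (sin (t * x) - t * x) - t / tau * (sin (tau * x) - tau * x).
  by field; rewrite gt_eqF.
rewrite (le_trans (ler_normB _ _))// mulrDl -exprMn lerD ?abs_sin_sub_id_sq//.
rewrite normrM normrM normfV (gtr0_norm tau0).
rewrite (le_trans (ler_wpM2l _ (abs_sin_sub_id_sq _)))//.
  by rewrite divr_ge0// ltW.
by rewrite le_eqVlt; apply/orP; left; apply/eqP; field; rewrite gt_eqF.
Qed.

Lemma sin_comb_cube tau t x : 0 < tau ->
  `|sin (t * x) - t / tau * sin (tau * x)| <= (`|t| ^+ 3 + `|t| * tau ^+ 2) / 6 * `|x| ^+ 3.
Proof.
move=> tau0.
have -> : sin (t * x) - t / tau * sin (tau * x) =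
  (sin (t * x) - t * x) - t / tau * (sin (tau * x) - tau * x).
  by field; rewrite gt_eqF.
rewrite (le_trans (ler_normB _ _))//.
have h1 := abs_sin_sub_id_cube (t * x); have h2 := abs_sin_sub_id_cube (tau * x).
rewrite normrM in h1; rewrite normrM (gtr0_norm tau0) in h2.
rewrite [X in _ + X]normrM normrM normfV (gtr0_norm tau0).
have tt : 0 <= `|t| / tau by rewrite divr_ge0// ltW.
have := ler_wpM2l tt h2.
have -> : `|t| / tau * ((tau * `|x|) ^+ 3 / 6) = `|t| * tau ^+ 2 / 6 * `|x| ^+ 3.
  by field; rewrite gt_eqF.
move: h1; rewrite exprMn; set y := `|x| ^+ 3; lra.
Qed.

Lemma LKsin_bound tau t x : 0 < tau ->
  `|LKsin tau t x| <= (1 + `|t| / tau) + (t ^+ 2 + `|t| * tau).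
Proof.
move=> tau0; have tt : 0 <= `|t| / tau by rewrite divr_ge0// ltW.
have t2 : 0 <= `|t| * tau by rewrite mulr_ge0// ltW.
rewrite /LKsin; case: eqVneq => [_|x0].
  by rewrite normr0; have := sqr_ge0 t; lra.
apply: weighted_bound => //; last exact: sin_comb_sq.
rewrite (le_trans (ler_normB _ _))// lerD ?sin_max//.
by rewrite normrM normrM normfV (gtr0_norm tau0) ler_piMr// sin_max.
Qed.

Lemma sqr_le_norm x : `|x| <= 1 -> x ^+ 2 <= `|x|.
Proof. by move=> x1; rewrite -(real_normK (num_real x)) expr2 ler_piMr. Qed.

Lemma LKcos_continuous t : continuous (LKcos t).
Proof.
apply: (@cont_of_bound _ (t ^+ 4 / 24 + t ^+ 2 / 2) (@LKcos_cont_off0 t)) => x x1.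
rewrite /LKcos eqxx; case: eqVneq => [->|x0].
  by rewrite subrr !normr0 mulr0.
have := sqr_le_norm x1 => x2.
have xx : 0 < x ^+ 2 by rewrite exprn_even_gt0.
have := one_sub_cos_bounds (t * x); set c := cos _ => /andP[h1 h2].
have t4 : 0 <= t ^+ 4 by rewrite exprn_even_ge0.
have t2 := sqr_ge0 t.
apply: (@le_trans _ _ ((t ^+ 4 / 24 + t ^+ 2 / 2) * x ^+ 2)); last first.
  by rewrite ler_wpM2l//; lra.
have -> : (c - 1) * LKweight x - - (t ^+ 2 / 2) =
   (c - 1) + (c - 1 + (t * x) ^+ 2 / 2) / x ^+ 2.
  by rewrite /LKweight; field.
rewrite (le_trans (ler_normD _ _))// [leLHS]addrC [leRHS]mulrDl lerD//.
  rewrite normrM normfV (gtr0_norm xx) ler_pdivrMr//.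
  rewrite ger0_norm; last by lra.
  have -> : t ^+ 4 / 24 * x ^+ 2 * x ^+ 2 = (t * x) ^+ 4 / 24 by rewrite exprMn; ring.
  lra.
rewrite distrC ger0_norm; last by have := cos_le1 (t * x); rewrite -/c; lra.
by move: h2; rewrite exprMn; lra.
Qed.

(** The combination of sines is of order 3 at the origin, one more than the weight
  removes. *)
Lemma LKsin_continuous tau t : 0 < tau -> continuous (LKsin tau t).
Proof.
move=> tau0.
apply: (@cont_of_bound _ ((`|t| ^+ 3 + `|t| * tau ^+ 2) / 3) (@LKsin_cont_off0 tau t)) => x x1.
rewrite /LKsin eqxx subr0; case: eqVneq => [->|x0].
  by rewrite !normr0 mulr0.
have xx : 0 < x ^+ 2 by rewrite exprn_even_gt0.
have := sin_comb_cube t x tau0; set y := sin _ - _.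
set C := _ + _ => hy.
have C0 : 0 <= C by rewrite addr_ge0// ?mulr_ge0// ?exprn_ge0// ltW.
rewrite normrM (gtr0_norm (weight_gt0 x0)) /LKweight mulrA ler_pdivrMr//.
apply: (@le_trans _ _ (C / 6 * `|x| ^+ 3 * 2)).
  rewrite ler_pM//; first by rewrite addr_ge0// ltW.
  by have := sqr_le_norm x1; lra.
have -> : x ^+ 2 = `|x| ^+ 2 by rewrite real_normK// num_real.
by rewrite le_eqVlt; apply/orP; left; apply/eqP; field.
Qed.

Lemma sinc_continuous d : continuous (sinc d).
Proof.
apply: (@cont_of_bound _ (d ^+ 2) (@sinc_cont_off0 d)) => x x1.
rewrite /sinc eqxx; case: eqVneq => [->|x0].
  by rewrite subrr !normr0 mulr0.
have -> : sin (d * x) / x - d = (sin (d * x) - d * x) / x by field.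
rewrite normrM normfV ler_pdivrMr ?normr_gt0// -mulrA -expr2 real_normK ?num_real//.
by rewrite -exprMn abs_sin_sub_id_sq.
Qed.

(** This is where a bounded kernel acquires decay at infinity. *)
Lemma sinc_vanishing d (f : R -> R) (C : R) : (forall x, `|f x| <= C) ->
  vanishing (fun x => 2 * sinc d x * f x).
Proof.
move=> fC e e0; have C0 : 0 <= C by exact: le_trans (fC 0).
exists (2 * C / e + 1) => x Ax.
have q0 : 0 <= 2 * C / e by rewrite divr_ge0 ?mulr_ge0// ltW.
have x0 : 0 < `|x| by lra.
have xn0 : x != 0 by rewrite -normr_gt0.
rewrite /sinc (negbTE xn0).
rewrite !normrM normfV (ger0_norm (_ : 0 <= 2))//.
have : `|sin (d * x)| * `|f x| <= 1 * C by rewrite ler_pM// sin_max.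
rewrite mul1r => h.
have -> : 2 * (`|sin (d * x)| / `|x|) * `|f x| = 2 * (`|sin (d * x)| * `|f x|) / `|x|.
  by field; rewrite gt_eqF.
rewrite ler_pdivrMr//; have : 2 * C <= e * `|x|.
  by rewrite mulrC -ler_pdivrMl// mulrC; lra.
lra.
Qed.

End kernels.

(** * The kernels, their primitives and their window averages *)

Section LK.
Context {R : realType}.
Implicit Types (t x d tau : R).

(** A primitive that vanishes at t = 0 inherits its bound from the kernel by the mean
  value theorem. *)
Lemma mk_kernel (k K : R -> R -> R) :
  (forall x t : R, is_derive t 1 (K ^~ x) (k t x)) ->
  (forall x : R, continuous (k ^~ x)) ->
  (forall t, cont_off0 (k t)) -> (forall t, cont_off0 (K t)) ->
  (forall x, K 0 x = 0) ->
  (forall T : R, exists C, forall t x, `|t| <= T -> `|k t x| <= C) ->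
  diff_kernel k K.
Proof.
move=> dK ck mk mK K0 lb; split => // [t|t]; first exact: cont_off0_measurable.
split; first exact: cont_off0_measurable.
have [C hC] := lb `|t|; exists (`|t| * C) => x.
have cK (a b : R) : {within `[a, b], continuous (K ^~ x)}.
  apply: continuous_subspaceT => s.
  by apply/differentiable_continuous/derivable1_diffP; case: (dK x s).
have [t0|/ltW t0] := leP 0 t.
  have [s] := MVT_segment t0 (fun s _ => dK x s) (cK _ _).
  rewrite in_itv/= K0 !subr0 => /andP[s0 st] ->.
  by rewrite normrM mulrC ler_wpM2l// hC// !ger0_norm.
have [s] := MVT_segment t0 (fun s _ => dK x s) (cK _ _).
rewrite in_itv/= K0 => /andP[s0 st].
rewrite sub0r => /eqP; rewrite eqr_oppLR => /eqP ->.
rewrite sub0r mulrN opprK normrM mulrC ler_wpM2l// hC//.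
by rewrite !ler0_norm// lerN2.
Qed.

Lemma LKcos_kernel : diff_kernel (@LKcos R) (@LKcos_prim R).
Proof.
apply: mk_kernel.
- move=> x t; rewrite /LKcos_prim /LKcos; case: eqVneq => [_|x0].
    by apply: is_derive_eq; rewrite /GRing.scale/=; field.
  have d1 : is_derive t 1 (fun s => sin (s * x)) (cos (t * x) * x).
    by apply: is_derive_eq; rewrite /GRing.scale/=; ring.
  by apply: is_derive_eq; rewrite /GRing.scale/=; field.
- move=> x t; rewrite /LKcos; case: eqVneq => [_|x0].
    by apply: cvgN; apply: cvgMr_tmp; exact: exprn_continuous.
  apply: cvgMr_tmp; apply: cvgB; last exact: cvg_cst.
  by apply: continuous_comp; [exact: mulrr_continuous|exact: continuous_cos].
- exact: LKcos_cont_off0.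
- exact: LKcos_prim_cont_off0.
- move=> x; rewrite /LKcos_prim; case: eqVneq => _; first by rewrite expr0n/= mul0r oppr0.
  by rewrite mul0r sin0 mul0r subrr mul0r.
- move=> T; exists (2 + `|T| ^+ 2 / 2) => t x tT; rewrite (le_trans (LKcos_bound t x))//.
  rewrite lerD2l ler_wpM2r// -(real_normK (num_real t)).
  by rewrite ler_pXn2r ?nnegrE// (le_trans tT)// ler_norm.
Qed.

Lemma LKsin_kernel tau : 0 < tau -> diff_kernel (LKsin tau) (LKsin_prim tau).
Proof.
move=> tau0; apply: mk_kernel.
- move=> x t; rewrite /LKsin_prim /LKsin; case: eqVneq => [_|x0]; first exact: is_derive_cst.
  have d1 : is_derive t 1 (fun s => cos (s * x)) (- sin (t * x) * x).
    by apply: is_derive_eq; rewrite /GRing.scale/=; ring.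
  apply: is_derive_eq; rewrite /GRing.scale/=; field.
  by rewrite x0 gt_eqF.
- move=> x t; rewrite /LKsin; case: eqVneq => [_|x0]; first exact: cvg_cst.
  apply: cvgMr_tmp; apply: cvgB.
    by apply: continuous_comp; [exact: mulrr_continuous|exact: continuous_sin].
  by apply: cvgMr_tmp; apply: cvgMr_tmp; exact: cvg_id.
- exact: LKsin_cont_off0.
- exact: LKsin_prim_cont_off0.
- move=> x; rewrite /LKsin_prim; case: eqVneq => // _.
  by rewrite mul0r cos0 subrr mul0r expr0n/= !mul0r subrr mul0r.
- move=> T; exists ((1 + `|T| / tau) + (`|T| ^+ 2 + `|T| * tau)) => t x tT.
  rewrite (le_trans (LKsin_bound t x tau0))//.
  have tT' : `|t| <= `|T| by rewrite (le_trans tT)// ler_norm.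
  rewrite lerD// ?lerD2l ?ler_wpM2r ?invr_ge0 ?(ltW tau0)//.
  rewrite lerD ?ler_wpM2r ?(ltW tau0)// -(real_normK (num_real t)).
  by rewrite ler_pXn2r ?nnegrE.
Qed.

(** The terms of the primitive linear in [t] have the same increment over both windows,
  and the windows of sin (s x) / x factor as 2 cos (t x) sin (d x) / x. *)
Lemma window_LKcos d t x :
  window (@LKcos_prim R) d t x - 1 * window (@LKcos_prim R) d 0 x = 2 * sinc d x * LKcos t x.
Proof.
rewrite /window /LKcos_prim /LKcos /sinc; case: eqVneq => [_|x0]; first by field.
rewrite (mulrDl t d x) (mulrBl x t d) sinD sinB add0r sub0r mulNr sinN.
set w := LKweight x; set s := sin (t * x); set s' := sin (d * x).
by set c := cos (t * x); set c' := cos (d * x); field.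
Qed.

(** The primitive of the centering is quadratic in [t], so its window is proportional to
  [t], and subtracting t / tau times the window at [tau] eliminates it. *)
Lemma window_LKsin tau d t x : 0 < tau ->
  window (LKsin_prim tau) d t x - t / tau * window (LKsin_prim tau) d tau x = 2 * sinc d x * LKsin tau t x.
Proof.
move=> tau0; have tn0 : tau != 0 by rewrite gt_eqF.
rewrite /window /LKsin_prim /LKsin /sinc; case: eqVneq => [_|x0].
  by rewrite !subrr !mulr0 subrr.
rewrite (mulrDl t d x) (mulrBl x t d) (mulrDl tau d x) (mulrBl x tau d) !cosB !cosD.
set w := LKweight x; set s := sin (t * x); set s' := sin (d * x).
set c := cos (t * x); set c' := cos (d * x).
set s1 := sin (tau * x); set c1 := cos (tau * x).
by field; rewrite x0 tn0.
Qed.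

Lemma LKcos0 x : LKcos 0 x = 0.
Proof.
rewrite /LKcos; case: eqVneq => _; first by rewrite expr0n/= mul0r oppr0.
by rewrite mul0r cos0 subrr mul0r.
Qed.

Lemma LKsin_tau tau x : 0 < tau -> LKsin tau tau x = 0.
Proof.
move=> tau0; rewrite /LKsin; case: eqVneq => // _.
by rewrite divff ?gt_eqF// mul1r subrr mul0r.
Qed.

Lemma LK_kernelE tau t x : LK_kernel tau t x = (LKcos t x +i* LKsin tau t x)%C.
Proof.
rewrite /LK_kernel /LKcos /LKsin; case: eqVneq => // x0.
rewrite /cexp /LKweight /=; simpc => /=.
rewrite expR0; simpc.
by congr (_ +i* _)%C; ring.
Qed.

Lemma cexp_iE (y : R) : cexp ('i%C * y%:C%C) = (cos y +i* sin y)%C.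
Proof. by rewrite /cexp /=; simpc => /=; rewrite expR0; simpc. Qed.

Lemma char_funE (F : cumulativeBounded (0 : R) (1 : R)) t :
  char_fun F t = ((\int[lebesgue_stieltjes_measure F]_x cos (t * x)) +i*
                  (\int[lebesgue_stieltjes_measure F]_x sin (t * x)))%C.
Proof.
rewrite /char_fun /complex_integral.
by congr (_ +i* _)%C; apply: eq_Rintegral => x _; rewrite cexp_iE.
Qed.

End LK.

(** * Uniqueness of characteristic functions *)

Section uniqueness.
Context {R : realType}.
Local Notation Meas := {measure set (measurableTypeR R) -> \bar R}.

Lemma cont_off0W (f : R -> R) : continuous f -> cont_off0 f.
Proof. by move=> cf x _; exact: cf. Qed.

Lemma cont_lin (lam a : R) : continuous (fun x => lam * (x - a)).
Proof.
by move=> x; apply: cvgMl_tmp; apply: cvgB; [exact: cvg_id|exact: cvg_cst].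
Qed.

Lemma int_diff_cvg (P N : Meas) (h_ : nat -> R -> R) h (C : R) :
  (P setT < +oo)%E -> (N setT < +oo)%E ->
  (forall n, continuous (h_ n)) -> (forall n x, `|h_ n x| <= C) ->
  (forall x, h_ n x @[n --> \oo] --> h x) ->
  int_diff P N (h_ n) @[n --> \oo] --> int_diff P N h.
Proof.
move=> fP fN ch hC hh; have mh n := continuous_measurable_fun (ch n).
by apply: cvgB; apply: cvg_int_bounded hh.
Qed.

Variables (P N : Meas).
Hypotheses (fP : (P setT < +oo)%E) (fN : (N setT < +oo)%E).
Hypothesis cosE : forall t, \int[P]_x cos (t * x) = \int[N]_x cos (t * x).
Hypothesis sinE : forall t, \int[P]_x sin (t * x) = \int[N]_x sin (t * x).

Lemma int_diff_limit0 (h_ : nat -> R -> R) h (C : R) :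
  (forall n, continuous (h_ n)) -> (forall n x, `|h_ n x| <= C) ->
  (forall x, h_ n x @[n --> \oo] --> h x) ->
  (forall n, int_diff P N (h_ n) = 0) -> int_diff P N h = 0.
Proof.
move=> ch hC hh h0; have := int_diff_cvg fP fN ch hC hh.
under eq_fun do rewrite h0.
by move=> /cvg_lim <-//; rewrite lim_cst.
Qed.

(** The integral of [K] is constant in the parameter since its derivative is 0. *)
Lemma kernel_int_diff0 (k K : R -> R -> R) : diff_kernel k K ->
  (forall x, K 0 x = 0) -> (forall t, int_diff P N (k t) = 0) ->
  forall t, int_diff P N (K t) = 0.
Proof.
move=> kK K0 k0 t.
have d0 (s : R) : is_derive s 1 (fun s => int_diff P N (K s)) 0.
  by rewrite -(k0 s); exact: (int_diff_derive kK).
rewrite (@is_derive_0_is_cst R (fun s => int_diff P N (K s)) t 0 d0).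
have -> : K 0 = cst 0 by apply/funext.
by rewrite /int_diff !Rintegral_cst// !mul0r subrr.
Qed.

Lemma int_diff_cos_affine (t a : R) : int_diff P N (fun x => cos (t * (x - a))) = 0.
Proof.
have bc : bounded_measurable (fun x : R => cos (t * x)).
  by apply: (@bounded_measurable_continuous _ _ 1); [exact: cont_cos_lin|move=> x; exact: cos_max].
have bs : bounded_measurable (fun x : R => sin (t * x)).
  by apply: (@bounded_measurable_continuous _ _ 1); [exact: cont_sin_lin|move=> x; exact: sin_max].
have -> : (fun x => cos (t * (x - a))) =
    (fun x => cos (t * a) * cos (t * x) - (- sin (t * a)) * sin (t * x)).
  by apply/funext => x; rewrite mulrBr cosB; ring.
rewrite int_diffB//; try exact: bounded_measurableZ.
by rewrite !int_diffZ// /int_diff cosE sinE !subrr !mulr0 subrr.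
Qed.

Let poisson_prim (lam a t x : R) : R := let u := lam * (x - a) in
  (expR (- t) * (u * sin (t * u) - cos (t * u)) + 1) / (1 + u ^+ 2).

Let oneD_gt0 (u : R) : 0 < 1 + u ^+ 2.
Proof. by rewrite ltr_pwDl// sqr_ge0. Qed.

Let poisson_prim_cont lam a t : continuous (poisson_prim lam a t).
Proof.
move=> x; rewrite /poisson_prim /=.
have cu : {for x, continuous (fun x => lam * (x - a))} by exact: cont_lin.
apply: cvgM.
  apply: cvgD; last exact: cvg_cst.
  apply: cvgMl_tmp; apply: cvgB.
    apply: cvgM; first exact: cont_lin.
    apply: (@continuous_comp _ _ _ (fun x => lam * (x - a)) (fun y => sin (t * y))) => //.
    exact: cont_sin_lin.
  apply: (@continuous_comp _ _ _ (fun x => lam * (x - a)) (fun y => cos (t * y))) => //.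
  exact: cont_cos_lin.
apply: cvgV; first by rewrite gt_eqF.
apply: cvgD; first exact: cvg_cst.
apply: (@continuous_comp _ _ _ (fun x => lam * (x - a)) (fun y => y ^+ 2)) => //.
exact: exprn_continuous.
Qed.

(** The primitive is the integral of exp (- s) cos (s u) over s in [0, t], with
  u = lam * (x - a). *)
Lemma poisson_kernel (lam a : R) :
  diff_kernel (fun t x => expR (- t) * cos (t * (lam * (x - a)))) (poisson_prim lam a).
Proof.
apply: mk_kernel.
- move=> x t; rewrite /poisson_prim; set u := lam * (x - a).
  have d1 : is_derive t 1 (fun s => cos (s * u)) (- sin (t * u) * u).
    by apply: is_derive_eq; rewrite /GRing.scale/=; ring.
  have d2 : is_derive t 1 (fun s => sin (s * u)) (cos (t * u) * u).
    by apply: is_derive_eq; rewrite /GRing.scale/=; ring.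
  have d3 : is_derive t 1 (fun s => expR (- s)) (- expR (- t)).
    by apply: is_derive_eq; rewrite /GRing.scale/=; ring.
  apply: is_derive_eq; rewrite /GRing.scale/=; field.
  by rewrite gt_eqF.
- move=> x t; apply: cvgM.
    by apply: continuous_comp; [exact: opp_continuous|exact: continuous_expR].
  by apply: continuous_comp; [exact: mulrr_continuous|exact: continuous_cos].
- move=> t; apply: cont_off0W => x; apply: cvgMl_tmp.
  apply: (@continuous_comp _ _ _ (fun x => lam * (x - a)) (fun y => cos (t * y))).
    exact: cont_lin.
  exact: cont_cos_lin.
- by move=> t; apply: cont_off0W; exact: poisson_prim_cont.
- move=> x; rewrite /poisson_prim mul0r sin0 cos0 mulr0 oppr0 expR0.
  by rewrite sub0r mul1r addNr mul0r.
- move=> T; exists (expR T) => t x tT.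
  rewrite normrM (ger0_norm (expR_ge0 _)) -[leRHS]mulr1 ler_pM// ?expR_ge0 ?cos_max//.
  by rewrite ler_expR; move: tT; rewrite ler_norml; lra.
Qed.

(** The Poisson kernel, the bounded limit of the previous primitives for t -> +oo. *)
Lemma int_diff_poisson0 (lam a : R) :
  int_diff P N (fun x => (1 + (lam * (x - a)) ^+ 2)^-1) = 0.
Proof.
(* The bound 3 comes from 2 |u| <= 1 + u ^ 2. *)
apply: (@int_diff_limit0 (fun n => poisson_prim lam a n%:R) _ 3).
- by move=> n; exact: poisson_prim_cont.
- move=> n x; rewrite /poisson_prim; set u := lam * (x - a).
  rewrite normrM normfV (gtr0_norm (oneD_gt0 u)) ler_pdivrMr//.
  rewrite (le_trans (ler_normD _ _))// normr1 normrM (ger0_norm (expR_ge0 _)).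
  have e1 : expR (- n%:R) <= 1 :> R by rewrite -expR0 ler_expR oppr_le0.
  have : expR (- n%:R) * `|u * sin (n%:R * u) - cos (n%:R * u)| <= 1 * (`|u| * 1 + 1).
    rewrite ler_pM ?expR_ge0// (le_trans (ler_normB _ _))// lerD ?cos_max//.
    by rewrite normrM ler_wpM2l// sin_max.
  have : 2 * `|u| <= 1 + u ^+ 2.
    by rewrite -(real_normK (num_real u)); have := sqr_ge0 (`|u| - 1); nra.
  have := sqr_ge0 u; lra.
- move=> x; rewrite /poisson_prim; set u := lam * (x - a).
  rewrite -[X in _ --> X]mul1r; apply: cvgMr_tmp.
  rewrite -[X in _ --> X]add0r; apply: cvgD; last exact: cvg_cst.
  have en : expR (- n%:R) * (`|u| + 1) @[n --> \oo] --> (0 : R).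
    rewrite -[X in _ --> X](mul0r (`|u| + 1)); apply: cvgMr_tmp.
    exact: cvgn_expR.
  apply: norm_cvg0; apply: (@squeeze_cvgr _ _ _ _ (cst 0) _ _ _ 0 (cvg_cst _) en).
  apply: nearW => n; rewrite normr_ge0/= normrM (ger0_norm (expR_ge0 _)).
  rewrite ler_wpM2l ?expR_ge0// (le_trans (ler_normB _ _))// lerD ?cos_max//.
  by rewrite normrM ler_piMr// sin_max.
- move=> n; apply: (kernel_int_diff0 (poisson_kernel lam a)).
    move=> x; rewrite /poisson_prim mul0r sin0 cos0 mulr0 oppr0 expR0.
    by rewrite sub0r mul1r addNr mul0r.
  move=> t; rewrite int_diffZ//.
    have -> : (fun x => cos (t * (lam * (x - a)))) = (fun x => cos (t * lam * (x - a))).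
      by apply/funext => x; rewrite mulrA.
    by rewrite int_diff_cos_affine mulr0.
  apply: (@bounded_measurable_continuous _ _ 1); last by move=> x; exact: cos_max.
  move=> x; apply: (@continuous_comp _ _ _ (fun x => lam * (x - a)) (fun y => cos (t * y))).
    exact: cont_lin.
  exact: cont_cos_lin.
Qed.


Lemma atan_kernel (lam : R) :
  diff_kernel (fun a x => (- lam) * (1 + (lam * (x - a)) ^+ 2)^-1)
              (fun a x => atan (lam * (x - a)) - atan (lam * x)).
Proof.
have cinv : continuous (fun u : R => (1 + u ^+ 2)^-1).
  move=> u; apply: cvgV; first by rewrite gt_eqF.
  by apply: cvgD; [exact: cvg_cst|exact: exprn_continuous].
have ca : continuous (@atan R) by move=> u; exact: continuous_atan.
have clin (x : R) : continuous (fun a => lam * (x - a)).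
  by move=> a; apply: cvgMl_tmp; apply: cvgB; [exact: cvg_cst|exact: cvg_id].
apply: mk_kernel.
- move=> x a.
  have d1 : is_derive a 1 (fun s : R => lam * (x - s)) (- lam).
    by apply: is_derive_eq; rewrite /GRing.scale/=; ring.
  have d2 := @is_derive1_comp R (@atan R) (fun s => lam * (x - s)) a _ _
    (is_derive1_atan (lam * (x - a))) d1.
  by apply: is_derive_eq; rewrite subr0 mulrC.
- move=> x a; apply: cvgMl_tmp.
  by apply: (@continuous_comp _ _ _ (fun a => lam * (x - a)) (fun u => (1 + u ^+ 2)^-1));
    [exact: clin|exact: cinv].
- move=> a; apply: cont_off0W => x; apply: cvgMl_tmp.
  by apply: (@continuous_comp _ _ _ (fun x => lam * (x - a)) (fun u => (1 + u ^+ 2)^-1));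
    [exact: cont_lin|exact: cinv].
- move=> a; apply: cont_off0W => x; apply: cvgB.
    by apply: continuous_comp; [exact: cont_lin|exact: ca].
  by apply: continuous_comp; [exact: mulrl_continuous|exact: ca].
- by move=> x; rewrite subr0 subrr.
- move=> T; exists `|lam| => a x _; rewrite normrM normrN ler_piMr//.
  by rewrite normfV (gtr0_norm (oneD_gt0 _)) invf_le1// lerDl sqr_ge0.
Qed.

Let abs_atan (u : R) : `|atan u| <= pi / 2.
Proof. by rewrite ler_norml !ltW ?atan_ltpi2 ?atan_gtNpi2. Qed.

Lemma cvgy_atan_seq (u_ : nat -> R) : u_ n @[n --> \oo] --> +oo ->
  atan (u_ n) @[n --> \oo] --> pi / 2.
Proof. by move=> uy; apply: cvg_comp uy _; exact: cvgy_atan. Qed.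

Lemma cvgNy_atan_seq (u_ : nat -> R) : - u_ n @[n --> \oo] --> +oo ->
  atan (u_ n) @[n --> \oo] --> - (pi / 2).
Proof.
move=> uy; have -> : (fun n => atan (u_ n)) = (fun n => - atan (- u_ n)).
  by apply/funext => n; rewrite atanN opprK.
by apply: cvgN; exact: cvgy_atan_seq.
Qed.

Lemma int_diff_cst0 (c : R) : int_diff P N (cst c) = 0.
Proof.
have := cosE 0; under eq_Rintegral do rewrite mul0r cos0.
under [RHS]eq_Rintegral do rewrite mul0r cos0.
rewrite !Rintegral_cst// !mul1r => PNT.
by rewrite /int_diff !Rintegral_cst// PNT subrr.
Qed.

Let batan (lam a : R) : bounded_measurable (fun x => atan (lam * (x - a))).
Proof.
apply: (@bounded_measurable_continuous _ _ (pi / 2)) => // x.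
by apply: continuous_comp; [exact: cont_lin|exact: continuous_atan].
Qed.

(** The derivative of arctan in [a] is a Poisson kernel, so the integral does not depend
  on [a]; for a -> +oo it tends to the integral of a constant. *)
Lemma int_diff_atan0 (lam a : R) : 0 < lam -> int_diff P N (fun x => atan (lam * (x - a))) = 0.
Proof.
move=> lam0.
have batan0 : bounded_measurable (fun x => atan (lam * x)).
  apply: (@bounded_measurable_continuous _ _ (pi / 2)) => // x.
  by apply: continuous_comp; [exact: mulrl_continuous|exact: continuous_atan].
have indep b : int_diff P N (fun x => atan (lam * (x - b))) = int_diff P N (fun x => atan (lam * x)).
  apply/eqP; rewrite -subr_eq0 -int_diffB//; apply/eqP.
  apply: (kernel_int_diff0 (atan_kernel lam)); first by move=> x; rewrite subr0 subrr.
  move=> t; rewrite int_diffZ// ?int_diff_poisson0 ?mulr0//.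
  apply: (@bounded_measurable_continuous _ _ 1) => x.
    apply: cvgV; first by rewrite gt_eqF.
    apply: cvgD; first exact: cvg_cst.
    apply: (@continuous_comp _ _ _ (fun x => lam * (x - t)) (fun u => u ^+ 2)).
      exact: cont_lin.
    exact: exprn_continuous.
  by rewrite normfV (gtr0_norm (oneD_gt0 _)) invf_le1// lerDl sqr_ge0.
rewrite indep.
have ch n : continuous (fun x : R => atan (lam * (x - n%:R))).
  by move=> x; apply: continuous_comp; [exact: cont_lin|exact: continuous_atan].
have hh x : atan (lam * (x - n%:R)) @[n --> \oo] --> - (pi / 2).
  apply: cvgNy_atan_seq; apply/cvgryPge => A; near=> n.
  have nA : A / lam + x <= n%:R by near: n; exact: nbhs_infty_ger.
  have : A / lam <= n%:R - x by lra.
  by rewrite ler_pdivrMr// mulrC; lra.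
have := int_diff_cvg fP fN ch (fun n x => abs_atan (lam * (x - n%:R))) hh.
under eq_fun do rewrite indep.
rewrite -[X in _ --> X]/(int_diff P N (cst (- (pi / 2)))) int_diff_cst0.
by move=> /cvg_lim <-//; rewrite lim_cst.
Unshelve. all: by end_near. Qed.

(** The centres a + 1 / (n + 1) approach [a] from the right, more slowly than the scales
  1 / (n + 1)^2 shrink, so that the arctangents also converge at [x = a], and there to
  - pi / 2. *)
Lemma rays_eq (a : R) : P `]-oo, a]%classic = N `]-oo, a]%classic.
Proof.
pose lam n : R := n.+1%:R ^+ 2.
pose b n : R := a + n.+1%:R^-1.
have n0 n : 0 < n.+1%:R :> R by [].
pose I : R -> R := \1_(`]-oo, a]%classic).
have hh x : atan (lam n * (x - b n)) @[n --> \oo] --> pi / 2 - pi * I x.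
  have E n : lam n * (x - b n) = (x - a) * n.+1%:R ^+ 2 - n.+1%:R.
    by rewrite /lam /b; field; rewrite gt_eqF.
  under eq_fun do rewrite E.
  have [xa|ax] := leP x a.
    rewrite /I indicE mem_set/= ?in_itv//= mulr1.
    have -> : pi / 2 - pi = - (pi / 2) :> R by field.
    apply: cvgNy_atan_seq; apply/cvgryPge => A; near=> n.
    have nA : A <= n%:R by near: n; exact: nbhs_infty_ger.
    have : 0 <= (a - x) * n.+1%:R ^+ 2 by rewrite mulr_ge0 ?sqr_ge0// subr_ge0.
    rewrite -natr1; lra.
  rewrite /I indicE memNset/= ?in_itv/= ?mulr0 ?subr0; last by rewrite leNgt ax.
  apply: cvgy_atan_seq; apply/cvgryPge => A; near=> n.
  have xa : 0 < x - a by rewrite subr_gt0.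
  have nA : (`|A| + 1) / (x - a) <= n%:R by near: n; exact: nbhs_infty_ger.
  have h1 : `|A| + 1 <= (x - a) * n.+1%:R.
    rewrite mulrC -ler_pdivrMr// (le_trans nA)// ler_nat//.
  have h2 : 1 <= n.+1%:R :> R by rewrite ler1n.
  have -> : (x - a) * n.+1%:R ^+ 2 - n.+1%:R = ((x - a) * n.+1%:R - 1) * n.+1%:R by ring.
  apply: (@le_trans _ _ (`|A| * 1)); first by rewrite mulr1 ler_norm.
  by rewrite ler_pM//; lra.
have ch n : continuous (fun x : R => atan (lam n * (x - b n))).
  by move=> x; apply: continuous_comp; [exact: cont_lin|exact: continuous_atan].
have lam0 n : 0 < lam n by rewrite exprn_gt0.
have := int_diff_limit0 ch (fun n x => abs_atan (lam n * (x - b n))) hh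
  (fun n => int_diff_atan0 (b n) (lam0 n)).
have mI : measurable (`]-oo, a]%classic : set (measurableTypeR R)) by exact: measurable_itv.
have bI : bounded_measurable I.
  split; first by apply: measurable_indic.
  by exists 1 => x; rewrite /I indicE ger0_norm// lern1 leq_b1.
rewrite int_diffB//; last 2 first.
- by split; [exact: measurable_cst|exists `|pi / 2|].
- exact: bounded_measurableZ.
rewrite int_diff_cst0 int_diffZ// sub0r => /eqP; rewrite oppr_eq0 mulf_eq0 gt_eqF ?pi_gt0//=.
rewrite /int_diff /Rintegral !integral_indic// !setIT subr_eq0 => /eqP.
have ray_fin (Q : Meas) : (Q setT < +oo)%E -> Q `]-oo, a]%classic \is a fin_num.
  move=> fQ; rewrite ge0_fin_numE// (le_lt_trans _ fQ)// le_measure ?inE//.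
by move=> h; rewrite -[LHS]fineK ?ray_fin// -[RHS]fineK ?ray_fin// h.
Unshelve. all: by end_near. Qed.

Lemma char_fun_measure_unique A : measurable A -> P A = N A.
Proof.
apply: eq_finite_measure_ocitv => // a b ab.
have -> : `]a, b]%classic = (`]-oo, b]%classic `\` `]-oo, a]%classic : set R).
  by rewrite -[RHS]setCK setCD setCitvl setUC -[LHS]setCK setCitv.
have sub : `]-oo, b]%classic `&` `]-oo, a]%classic = (`]-oo, a]%classic : set R).
  by rewrite setIidr//; exact: subset_itvl.
rewrite !measureD//= ?sub ?rays_eq//;
  by apply: (le_lt_trans _ fN); apply: le_measure; rewrite ?inE//; exact: measurable_itv.
Qed.

End uniqueness.

(** * Characteristic functions under weak convergence *)

Section core.
Context {R : realType}.
Local Notation Meas := {measure set (measurableTypeR R) -> \bar R}.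
Local Notation ls := (@lebesgue_stieltjes_measure R).
Local Notation df := (cumulativeBounded (0 : R) (1 : R)).

Lemma prob_setT (F : df) : ls F setT = 1%E.
Proof. exact: (@probability_setT _ _ _ (ls F)). Qed.

Lemma prob_lty (F : df) : (ls F setT < +oo)%E.
Proof. by rewrite prob_setT ltry. Qed.

Lemma weak_cvg_cos (F_ : nat -> df) (F : df) (t : R) : weak_cvg F_ F ->
  \int[ls (F_ n)]_x cos (t * x) @[n --> \oo] --> \int[ls F]_x cos (t * x).
Proof.
move=> wF; apply: wF; first exact: cont_cos_lin.
exists 1; split; first exact: num_real.
by move=> M M1 x _; rewrite /= (le_trans (cos_max _))// ltW.
Qed.

Lemma weak_cvg_sin (F_ : nat -> df) (F : df) (t : R) : weak_cvg F_ F ->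
  \int[ls (F_ n)]_x sin (t * x) @[n --> \oo] --> \int[ls F]_x sin (t * x).
Proof.
move=> wF; apply: wF; first exact: cont_sin_lin.
exists 1; split; first exact: num_real.
by move=> M M1 x _; rewrite /= (le_trans (sin_max _))// ltW.
Qed.

Let trunc (u x : R) : R := Num.min (u * `|x|) 2.

Let trunc_cont u : continuous (trunc u).
Proof.
move=> x; apply: (@continuous_min R R (fun x => u * `|x|) (cst 2)); last exact: cvg_cst.
by apply: cvgMl_tmp; exact: norm_continuous.
Qed.

Let trunc_bound u x : 0 <= u -> `|trunc u x| <= 2.
Proof.
move=> u0; rewrite ger0_norm ?ge_min ?lexx ?orbT//.
by rewrite le_min mulr_ge0//=.
Qed.

(** The increment is bounded by the integral of min (u |x|, 2), a bounded continuous
  function of [x] whose integral against the limit is small for small u; weak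
  convergence transfers this bound to almost all n. *)
Lemma weak_cvg_equicont (F_ : nat -> df) (F : df) (t : R) (f : R -> R) :
  weak_cvg F_ F -> continuous f -> (forall x, `|f x| <= 1) ->
  (forall x y, `|f x - f y| <= `|x - y|) ->
  equicont_at (fun n b => \int[ls (F_ n)]_x f (b * x)) t.
Proof.
move=> wF cf f1 flip e e0.
pose h m := trunc m.+1%:R^-1.
have hm0 m : 0 <= m.+1%:R^-1 :> R by rewrite invr_ge0.
have hlim : \int[ls F]_x h m x @[m --> \oo] --> 0.
  have E : \int[ls F]_x (cst 0 : R -> R) x = 0 by rewrite Rintegral_cst// mul0r.
  rewrite -[X in _ --> X]E.
  apply: (@cvg_int_bounded _ _ _ _ 2) => //.
  - exact: prob_lty.
  - by move=> m; apply: continuous_measurable_fun; exact: trunc_cont.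
  - by move=> m x; exact: trunc_bound.
  - move=> x.
    have en : m.+1%:R^-1 * `|x| @[m --> \oo] --> (0 : R).
      by rewrite -[X in _ --> X](mul0r `|x|); apply: cvgMr_tmp; exact: cvg_harmonic.
    apply: (@squeeze_cvgr _ _ _ _ (cst 0) _ _ _ 0 (cvg_cst _) en).
    apply: nearW => m; rewrite /h /trunc ge_min lexx andbT.
    by rewrite le_min mulr_ge0//=.
have e2 : 0 < e / 2 by rewrite divr_gt0.
have [m hm] : exists m, \int[ls F]_x h m x < e / 2.
  have /cvgrPdist_lt/(_ _ e2)[m _ /(_ m (leqnn m))] := hlim.
  by rewrite sub0r normrN => /(le_lt_trans (ler_norm _)) ?; exists m.
have wh : \int[ls (F_ n)]_x h m x @[n --> \oo] --> \int[ls F]_x h m x.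
  apply: wF; first exact: trunc_cont.
  exists 2; split; first exact: num_real.
  by move=> M M1 x _; rewrite /= (le_trans (trunc_bound _ _))// ltW.
exists (m.+1%:R^-1); first by rewrite invr_gt0.
have nearh : \forall n \near \oo, \int[ls (F_ n)]_x h m x < e / 2.
  exact: (cvgr_lt _ wh _ hm).
apply: filterS nearh => n hn b bt.
have bf (s : R) : bounded_measurable (fun x => f (s * x)).
  apply: (@bounded_measurable_continuous _ _ 1) => // x.
  by apply: (@continuous_comp _ _ _ (fun x => s * x) f); [exact: mulrl_continuous|exact: cf].
have fF := prob_lty (F_ n).
rewrite -RintegralB//; try exact: bounded_measurable_integrable.
have bd : bounded_measurable (fun x => f (b * x) - f (t * x)) by exact: bounded_measurableB.
have ib := bounded_measurable_integrable fF bd.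
rewrite (le_trans (le_normr_Rintegral _ ib))//.
apply: (@le_trans _ _ (\int[ls (F_ n)]_x h m x)); last first.
  by rewrite (le_trans (ltW hn))// ler_pdivrMr// ler_pMr// ler1n.
apply: le_Rintegral => //.
- apply: bounded_measurable_integrable => //; case: bd => [m1 [C hC]]; split.
    exact: measurableT_comp.
  by exists C => x; rewrite normr_id.
- apply: bounded_measurable_integrable => //; apply: (@bounded_measurable_continuous _ _ 2).
    exact: trunc_cont.
  by move=> x; exact: trunc_bound.
- move=> x _; rewrite /h /trunc le_min; apply/andP; split.
    rewrite (le_trans (flip _ _))// -mulrBl normrM ler_wpM2r//.
  by rewrite (le_trans (ler_normB _ _))// (_ : 2 = 1 + 1)// lerD.
Qed.

Lemma equicont_eq (f_ g_ : nat -> R -> R) (t : R) : (forall n b, f_ n b = g_ n b) ->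
  equicont_at f_ t -> equicont_at g_ t.
Proof.
move=> fg ef e e0; have [d d0 h] := ef e e0; exists d => //.
by apply: filterS h => n h b bt; rewrite -!fg h.
Qed.

(** Removes the drift t * gamma_n, whose slopes are bounded. *)
Lemma equicont_subl (s_ : nat -> R -> R) (g_ : nat -> R) (g t : R) :
  g_ n @[n --> \oo] --> g -> equicont_at s_ t ->
  equicont_at (fun n b => s_ n b - b * g_ n) t.
Proof.
move=> gg es e e0; have e2 : 0 < e / 2 by rewrite divr_gt0.
have [d d0 h] := es _ e2.
have g1 : 0 < `|g| + 1 by rewrite ltr_wpDl.
exists (Num.min d (e / 2 / (`|g| + 1))); first by rewrite lt_min d0/= divr_gt0.
have hg : \forall n \near \oo, `|g_ n| <= `|g| + 1.
  by apply: (@cvgr_norm_le _ _ _ _ _ g_ g gg); rewrite ltrDl.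
apply: filterS2 h hg => n h hg b; rewrite le_min => /andP[b1 b2].
have -> : s_ n b - b * g_ n - (s_ n t - t * g_ n) =
  (s_ n b - s_ n t) - (b - t) * g_ n by ring.
rewrite (le_trans (ler_normB _ _))// [leRHS](splitr e) lerD ?h// normrM.
rewrite -(divfK (lt0r_neq0 g1) (e / 2)) ler_pM//.
Qed.

Variables (tau : R) (tau0 : 0 < tau).

Lemma cexp_LK (gamma t : R) (G : R -> R) (A B : cumulative R R)
  (nu : {charge set (measurableTypeR R) -> \bar R}) :
  (ls A setT < +oo)%E -> (ls B setT < +oo)%E ->
  (forall x, G x = A x - B x) -> is_stieltjes_charge G nu ->
  let c := int_diff (ls A) (ls B) (LKcos t) in
  let s := t * gamma + int_diff (ls A) (ls B) (LKsin tau t) in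
  cexp ('i%C * (t * gamma)%:C%C + charge_integral nu (LK_kernel tau t)) =
  (expR c * cos s +i* (expR c * sin s))%C.
Proof.
move=> fA fB GE nuG c s.
rewrite (charge_integralE fA fB GE nuG).
- have -> : (fun x : R => complex.Re (LK_kernel tau t x)) = LKcos t.
    by apply/funext => x; rewrite LK_kernelE.
  have -> : (fun x : R => complex.Im (LK_kernel tau t x)) = LKsin tau t.
    by apply/funext => x; rewrite LK_kernelE.
  rewrite -/(int_diff (ls A) (ls B) _) -/(int_diff (ls A) (ls B) _) /cexp /=; simpc => /=.
  by [].
- have -> : (fun x : R => complex.Re (LK_kernel tau t x)) = LKcos t.
    by apply/funext => x; rewrite LK_kernelE.
  exact: (kernel_bounded_measurable (@LKcos_kernel R)).
- have -> : (fun x : R => complex.Im (LK_kernel tau t x)) = LKsin tau t.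
    by apply/funext => x; rewrite LK_kernelE.
  exact: (kernel_bounded_measurable (LKsin_kernel tau0)).
Qed.

End core.

(** * The limit of a weakly convergent sequence *)

Section limit.
Context {R : realType}.
Local Notation ls := (@lebesgue_stieltjes_measure R).
Local Notation df := (cumulativeBounded (0 : R) (1 : R)).

Definition LKre (A B : cumulative R R) (t : R) : R := int_diff (ls A) (ls B) (LKcos t).
Definition LKim (tau gamma : R) (A B : cumulative R R) (t : R) : R :=
  t * gamma + int_diff (ls A) (ls B) (LKsin tau t).
(** The exponential of t |-> i t gamma + integral of the kernel, in polar form. *)
Definition LKfun (tau gamma : R) (A B : cumulative R R) (t : R) : R[i] :=
  (expR (LKre A B t) * cos (LKim tau gamma A B t) +i*
   (expR (LKre A B t) * sin (LKim tau gamma A B t)))%C.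

Lemma LKfun_limit (tau : R) (tau0 : 0 < tau) (F_ : nat -> df) (F : df)
  (gamma_ : nat -> R) (gamma : R) (A_ B_ : nat -> cumulative R R)
  (A B : cumulative R R) (M : R) (D : set R) :
  weak_cvg F_ F -> gamma_ n @[n --> \oo] --> gamma ->
  (forall n, ls (A_ n) setT <= M%:E)%E -> (forall n, ls (B_ n) setT <= M%:E)%E ->
  (ls A setT <= M%:E)%E -> (ls B setT <= M%:E)%E -> countable D ->
  (forall a b, ~ D a -> ~ D b ->
    (A_ n b - B_ n b) - (A_ n a - B_ n a) @[n --> \oo] --> (A b - B b) - (A a - B a)) ->
  (forall n t, char_fun (F_ n) t = LKfun tau (gamma_ n) (A_ n) (B_ n) t) ->
  forall t, char_fun F t = LKfun tau gamma A B t.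
Proof.
move=> wF gcv AM_ BM_ AM BM cD Gcv FE.
have M0 : 0 <= M by rewrite -lee_fin (le_trans _ AM).
pose c_ n := LKre (A_ n) (B_ n).
pose s_ n := LKim tau (gamma_ n) (A_ n) (B_ n).
have fin Q : (ls Q setT <= M%:E)%E -> (ls Q setT < +oo)%E by exact: lee_lty.
have cosE n t : \int[ls (F_ n)]_x cos (t * x) = expR (c_ n t) * cos (s_ n t).
  by have := FE n t; rewrite char_funE => -[].
have sinE n t : \int[ls (F_ n)]_x sin (t * x) = expR (c_ n t) * sin (s_ n t).
  by have := FE n t; rewrite char_funE => -[].
have s_cont n : continuous (s_ n).
  move=> t; apply: cvgD; first by apply: cvgMr_tmp; exact: cvg_id.
  by apply: (int_diff_continuous (LKsin_kernel tau0)); exact: fin.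
have c_bound t : \forall n \near \oo, `|c_ n t| <= 2 * ((2 + t ^+ 2 / 2) * M).
  have C0 : 0 <= 2 + t ^+ 2 / 2 by rewrite addr_ge0// divr_ge0// sqr_ge0.
  have mk := (kernel_bounded_measurable (@LKcos_kernel R) t).1.
  apply: nearW => n; exact: (le_int_diff (AM_ n) (BM_ n) C0 mk (LKcos_bound t)).
have equi t : equicont_at c_ t /\ equicont_at s_ t.
  apply: (equicont_polar s_cont (c_bound t)).
  - apply: (equicont_eq (f_ := fun n b => \int[ls (F_ n)]_x cos (b * x))) => //.
    apply: (weak_cvg_equicont (f := cos) _ wF) => //.
    + exact: continuous_cos.
    + by move=> x; exact: cos_max.
    + exact: abs_cosB_le.
  - apply: (equicont_eq (f_ := fun n b => \int[ls (F_ n)]_x sin (b * x))) => //.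
    apply: (weak_cvg_equicont (f := sin) _ wF) => //.
    + exact: continuous_sin.
    + by move=> x; exact: sin_max.
    + exact: abs_sinB_le.
have vague a b : ~ D a -> ~ D b -> a <= b ->
    fine (ls (A_ n) `]a, b]%classic) - fine (ls (B_ n) `]a, b]%classic) @[n --> \oo] -->
    fine (ls A `]a, b]%classic) - fine (ls B `]a, b]%classic).
  move=> Da Db ab.
  have E (X Y : cumulative R R) :
      fine (ls X `]a, b]%classic) - fine (ls Y `]a, b]%classic) =
      (X b - Y b) - (X a - Y a) by rewrite !lebesgue_stieltjes_itv//=; lra.
  by rewrite E; under eq_fun do rewrite E; exact: Gcv.
(* The real part of the kernel is identically 0 at the parameter 0, the imaginary part
   at the parameter tau. *)
have c_cvg t : c_ n t @[n --> \oo] --> LKre A B t.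
  have wE d : (fun x => window (@LKcos_prim R) d t x - 1 * window (@LKcos_prim R) d 0 x) =
      (fun x => 2 * sinc d x * LKcos t x) by apply/funext => x; exact: window_LKcos.
  apply: (kernel_cvg (@LKcos_kernel R) (t0 := 0) (kap := 1) AM_ BM_ AM BM cD vague).
  - exact: LKcos0.
  - move=> d d0; rewrite wE => x; apply: cvgM; last exact: LKcos_continuous.
    by apply: cvgMl_tmp; exact: sinc_continuous.
  - by move=> d d0; rewrite wE; apply: sinc_vanishing => x; exact: LKcos_bound.
  - by have [] := equi t.
  - by have [] := equi 0.
have equis t : equicont_at (fun n b => int_diff (ls (A_ n)) (ls (B_ n)) (LKsin tau b)) t.
  apply: (equicont_eq (f_ := fun n b => s_ n b - b * gamma_ n)).
    by move=> n b; rewrite /s_ /LKim addrAC subrr add0r.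
  by apply: (equicont_subl gcv); have [] := equi t.
have s_cvg t : s_ n t @[n --> \oo] --> LKim tau gamma A B t.
  apply: cvgD; first exact: cvgMl_tmp.
  have wE d : (fun x => window (LKsin_prim tau) d t x - t / tau * window (LKsin_prim tau) d tau x) =
      (fun x => 2 * sinc d x * LKsin tau t x) by apply/funext => x; exact: window_LKsin.
  apply: (kernel_cvg (LKsin_kernel tau0) (t0 := tau) (kap := t / tau) AM_ BM_ AM BM cD vague).
  - by move=> x; exact: LKsin_tau.
  - move=> d d0; rewrite wE => x; apply: cvgM; last exact: LKsin_continuous.
    by apply: cvgMl_tmp; exact: sinc_continuous.
  - by move=> d d0; rewrite wE; apply: sinc_vanishing => x; exact: LKsin_bound.
  - exact: equis.
  - exact: equis.
move=> t; rewrite char_funE /LKfun.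
have e_cvg : expR (c_ n t) @[n --> \oo] --> expR (LKre A B t).
  by apply: (cvg_comp _ _ (c_cvg t)); exact: continuous_expR.
congr (_ +i* _)%C.
- have h : \int[ls (F_ n)]_x cos (t * x) @[n --> \oo] -->
      expR (LKre A B t) * cos (LKim tau gamma A B t).
    under eq_fun do rewrite cosE.
    apply: cvgM => //.
    by apply: (cvg_comp _ _ (s_cvg t)); exact: continuous_cos.
  by rewrite -(cvg_lim (@Rhausdorff R) (weak_cvg_cos (t := t) wF))// (cvg_lim (@Rhausdorff R) h).
- have h : \int[ls (F_ n)]_x sin (t * x) @[n --> \oo] -->
      expR (LKre A B t) * sin (LKim tau gamma A B t).
    under eq_fun do rewrite sinE.
    apply: cvgM => //.
    by apply: (cvg_comp _ _ (s_cvg t)); exact: continuous_sin.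
  by rewrite -(cvg_lim (@Rhausdorff R) (weak_cvg_sin (t := t) wF))// (cvg_lim (@Rhausdorff R) h).
Qed.

End limit.

(** * Total masses and subsequences *)

Section preparations.
Context {R : realType}.
Local Notation ls := (@lebesgue_stieltjes_measure R).
Local Notation df := (cumulativeBounded (0 : R) (1 : R)).

Lemma bounded_above_of_near (u : nat -> R) (M : R) :
  (\forall n \near \oo, u n <= M) -> exists K, forall n, u n <= K.
Proof.
move=> [N _ hN]; exists (`|M| + \sum_(i < N) `|u i|) => n.
have [Nn|nN] := leqP N n.
  rewrite (le_trans (hN n Nn))// (le_trans (ler_norm M))// lerDl.
  by apply: sumr_ge0.
rewrite (bigD1 (Ordinal nN))//= (le_trans (ler_norm (u n)))//.
by rewrite addrCA lerDl addr_ge0// sumr_ge0.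
Qed.

(** If the upper limit is not +oo, some supremum of a tail is already finite. *)
Lemma bounded_above_of_limsup (u : nat -> R) :
  (limn_esup (fun n => (u n)%:E) < +oo)%E -> exists K, forall n, u n <= K.
Proof.
move=> ulim.
have [N hN] : exists N, (esups (fun n => (u n)%:E) N < +oo)%E.
  apply: contrapT => nex.
  have E : esups (fun n => (u n)%:E) = cst +oo%E.
    apply/funext => n; apply/eqP; rewrite -leye_eq leNgt.
    by apply/negP => h; apply: nex; exists n.
  by move: ulim; rewrite limn_esup_lim E lim_cst.
have uN n : (N <= n)%N -> ((u n)%:E <= esups (fun n => (u n)%:E) N)%E.
  by move=> Nn; apply: ereal_sup_ubound; exists n.
apply: (@bounded_above_of_near _ (fine (esups (fun n => (u n)%:E) N))).
exists N => // n Nn; rewrite -lee_fin fineK; first exact: uN.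
rewrite fin_numE; apply/andP; split; last by rewrite -ltey.
by rewrite -ltNye (lt_le_trans _ (uN N (leqnn N)))// ltNye.
Qed.

(** Bounded variation bounds a monotone function, which makes [at_pinfty] its actual
  limit. *)
Lemma class_V_nd_cvg (H : R -> R) : class_V H -> {homo H : x y / x <= y} ->
  H @ +oo --> at_pinfty H.
Proof.
move=> [[M HM] _ _] nd.
have ub : has_ubound (range H).
  exists (H 0 + `|M|) => _ [x _ <-].
  have [x0|/ltW x0] := leP 0 x; last by rewrite (le_trans (nd _ _ x0))// lerDl.
  have := le_trans (TV_ge HM x0) (TV_le HM x0); rewrite ler_norml => /andP[_].
  have := ler_norm M; lra.
have := nondecreasing_cvgr nd ub => /[dup] /cvg_lim E.
by rewrite /at_pinfty E.
Qed.

Lemma class_V_nd_bounds (H : R -> R) : class_V H -> {homo H : x y / x <= y} ->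
  forall x, 0 <= H x <= at_pinfty H.
Proof.
move=> VH nd x; apply/andP; split.
  have [_ _ H0] := VH; rewrite -(cvg_lim (@Rhausdorff R) H0).
  apply: limr_le; first by apply/cvg_ex; exists 0.
  near=> y; apply: nd; near: y; by apply: nbhs_ninfty_le; exact: num_real.
have Hy := class_V_nd_cvg VH nd; rewrite -(cvg_lim (@Rhausdorff R) Hy).
apply: limr_ge; first by apply/cvg_ex; eexists; exact: Hy.
near=> y; apply: nd; near: y; by apply: nbhs_pinfty_ge; exact: num_real.
Unshelve. all: by end_near. Qed.

Lemma extraction_comp (phi psi : nat -> nat) :
  extraction phi -> extraction psi -> extraction (phi \o psi).
Proof. by move=> hphi hpsi m n mn /=; apply: hphi; exact: hpsi. Qed.

Lemma extraction_ge (phi : nat -> nat) : extraction phi -> forall n, (n <= phi n)%N.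
Proof.
move=> hphi; elim=> [//|n IHn].
by rewrite (leq_ltn_trans IHn)//; exact: hphi.
Qed.

Lemma extraction_cvg (u : nat -> R) (l : R) (phi : nat -> nat) :
  extraction phi -> u n @[n --> \oo] --> l -> u (phi n) @[n --> \oo] --> l.
Proof.
move=> hphi ul; apply: cvg_comp ul => A [N _ hN]; exists N => // n /= Nn.
by apply: hN; rewrite /= (leq_trans Nn)// extraction_ge.
Qed.

Lemma extraction_of_infinite (Q : nat -> Prop) :
  (forall N, exists2 n, (N <= n)%N & Q n) ->
  exists2 phi, extraction phi & forall k, Q (phi k).
Proof.
move=> inf; have /choice[f hf] : forall N, exists n, (N <= n)%N /\ Q n.
  by move=> N; have [n Nn Qn] := inf N; exists n.
pose phi := fix phi k := if k is k'.+1 then f (phi k').+1 else f 0%N.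
have step k : (phi k < phi k.+1)%N by have [] := hf (phi k).+1.
exists phi.
  move=> m n; elim: n => [//|n IHn]; rewrite ltnS leq_eqVlt => /predU1P[->//|mn].
  exact: ltn_trans (IHn mn) (step n).
by case=> [|k]; [have [] := hf 0%N|have [] := hf (phi k).+1].
Qed.

(** Otherwise some subsequence stays at a positive distance from the limit. *)
Lemma cvg_of_extractions (u : nat -> R) (l : R) :
  (forall phi, extraction phi -> exists2 psi, extraction psi &
     u (phi (psi k)) @[k --> \oo] --> l) ->
  u n @[n --> \oo] --> l.
Proof.
move=> h; apply/cvgrPdist_lt => e e0; apply: contrapT => nb.
have [phi hphi far] : exists2 phi, extraction phi & forall k, e <= `|l - u (phi k)|.
  apply: (@extraction_of_infinite (fun n => e <= `|l - u n|)) => N.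
  apply: contrapT => nex; apply: nb; exists N => // n Nn.
  by rewrite /= ltNge; apply/negP => en; apply: nex; exists n.
have [psi _ /cvgrPdist_lt/(_ _ e0)[N _ /(_ N (leqnn N))]] := h phi hphi.
by rewrite /= ltNge far.
Qed.

End preparations.

Theorem theorem9 (R : realType) (tau : R) (tau_gt0 : 0 < tau)
    (F_ : nat -> cumulativeBounded (0 : R) (1 : R))
    (gamma_ : nat -> R) (G_ Gp_ Gm_ : nat -> R -> R)
    (F_qid : forall n, quasi_infinitely_divisible tau (F_ n))
    (F_pair : forall n, spectral_pair tau (F_ n) (gamma_ n) (G_ n))
    (Gp_V : forall n, class_V (Gp_ n))
    (Gm_V : forall n, class_V (Gm_ n))
    (Gp_nd : forall n, {homo Gp_ n : x y / x <= y})
    (Gm_nd : forall n, {homo Gm_ n : x y / x <= y})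
    (G_dec : forall n x, G_ n x = Gp_ n x - Gm_ n x)
    (Gm_limsup : (limn_esup (fun n => (at_pinfty (Gm_ n))%:E) < +oo)%E)
    (F_rc : relatively_compact F_)
    (gamma : R) (G : R -> R) (G_V : class_V G)
    (gamma_cvg : gamma_ n @[n --> \oo] --> gamma)
    (G_cvg : basic_cvg G_ G)
    (Gy_cvg : at_pinfty (G_ n) @[n --> \oo] --> at_pinfty G) :
  exists F : cumulativeBounded (0 : R) (1 : R),
    [/\ quasi_infinitely_divisible tau F,
        spectral_pair tau F gamma G
      & weak_cvg F_ F].
Proof.
have rc (H : R -> R) : class_V H -> right_continuous H by case.
pose A_ n := mk_cumulative (Gp_nd n) (rc _ (Gp_V n)).
pose B_ n := mk_cumulative (Gm_nd n) (rc _ (Gm_V n)).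
pose ls := @lebesgue_stieltjes_measure R.
have [Km hKm] := bounded_above_of_limsup Gm_limsup.
have at_dec n : at_pinfty (Gp_ n) = at_pinfty (G_ n) + at_pinfty (Gm_ n).
  have hp := class_V_nd_cvg (Gp_V n) (Gp_nd n).
  have hm := class_V_nd_cvg (Gm_V n) (Gm_nd n).
  have hG : G_ n @ +oo --> at_pinfty (Gp_ n) - at_pinfty (Gm_ n).
    have -> : G_ n = fun x => Gp_ n x - Gm_ n x by apply/funext.
    exact: cvgB.
  by rewrite [at_pinfty (G_ n)](cvg_lim (@Rhausdorff R) hG) subrK.
have [Kp hKp] : exists K, forall n, at_pinfty (Gp_ n) <= K.
  have nearG : \forall n \near \oo, at_pinfty (G_ n) <= at_pinfty G + 1.
    by apply: (cvgr_le _ Gy_cvg); rewrite ltrDl.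
  have [K hK] := bounded_above_of_near nearG.
  by exists (K + Km) => n; rewrite at_dec lerD.
have A_K n : (ls (A_ n) setT <= Kp%:E)%E.
  rewrite -[Kp]subr0; apply: lebesgue_stieltjes_setT_le => x /=.
  by have /andP[-> /le_trans ->] := class_V_nd_bounds (Gp_V n) (Gp_nd n) x.
have B_K n : (ls (B_ n) setT <= Km%:E)%E.
  rewrite -[Km]subr0; apply: lebesgue_stieltjes_setT_le => x /=.
  by have /andP[-> /le_trans ->] := class_V_nd_bounds (Gm_V n) (Gm_nd n) x.
have [A [B [Afin Bfin GE]]] := class_V_decomp G_V.
have [nu nuG] := stieltjes_charge_exists Afin Bfin GE.
have massE (C : cumulative R R) : (ls C setT < +oo)%E -> exists K, (ls C setT <= K%:E)%E.
  by move=> Cfin; exists (fine (ls C setT)); rewrite fineK// ge0_fin_numE.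
have [KA hKA] := massE _ Afin; have [KB hKB] := massE _ Bfin.
pose M := Num.max (Num.max Kp Km) (Num.max KA KB).
have leM K x : (x <= K%:E)%E -> K <= M -> (x <= M%:E)%E.
  by move=> xK KM; rewrite (le_trans xK)// lee_fin.
have F_LK n t : char_fun (F_ n) t = LKfun tau (gamma_ n) (A_ n) (B_ n) t.
  have [_ [nun nunG ->]] := F_pair n.
  apply: (@cexp_LK _ _ tau_gt0 _ _ (G_ n) (A_ n) (B_ n) nun _ _ (G_dec n) nunG).
  - exact: le_lt_trans (A_K n) (ltry _).
  - exact: le_lt_trans (B_K n) (ltry _).
(* The subsequence is thinned out twice, for weak and for basic convergence. *)
have limit phi : extraction phi -> exists2 psi, extraction psi &
    exists2 F, weak_cvg (fun k => F_ (phi (psi k))) F &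
      forall t, char_fun F t = LKfun tau gamma A B t.
  move=> hphi; have [psi1 hpsi1 [F wF]] := F_rc phi hphi.
  have h1 := extraction_comp hphi hpsi1.
  have [psi2 hpsi2 [D cD hD]] := G_cvg _ h1.
  exists (psi1 \o psi2); first exact: extraction_comp.
  have wF2 : weak_cvg (fun k => F_ (phi (psi1 (psi2 k)))) F.
    by move=> h ch bh; apply: (extraction_cvg hpsi2 (wF h ch bh)).
  exists F => //.
  apply: (@LKfun_limit _ _ tau_gt0 (fun k => F_ (phi (psi1 (psi2 k)))) F
    (fun k => gamma_ (phi (psi1 (psi2 k)))) gamma
    (fun k => A_ (phi (psi1 (psi2 k)))) (fun k => B_ (phi (psi1 (psi2 k)))) A B M D) => //.
  - exact: (@extraction_cvg _ gamma_ gamma _ (extraction_comp h1 hpsi2) gamma_cvg).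
  - by move=> n; apply: leM (A_K _) _; rewrite /M !le_max lexx.
  - by move=> n; apply: leM (B_K _) _; rewrite /M !le_max lexx orbT.
  - by apply: leM hKA _; rewrite /M !le_max lexx !orbT.
  - by apply: leM hKB _; rewrite /M !le_max lexx !orbT.
  - move=> a b Da Db; rewrite -!GE; have := hD a b Da Db.
    by under eq_fun do rewrite !G_dec.
have [psi _ [F _ FE]] := limit id (fun _ _ => id).
have F_spec : spectral_pair tau F gamma G.
  split=> //; exists nu => // t; rewrite FE.
  by rewrite (cexp_LK tau_gt0 _ _ Afin Bfin GE nuG).
exists F; split => //; first by exists gamma, G.
move=> h ch bh; apply: cvg_of_extractions => phi hphi.
have [psi' hpsi' [F' wF' F'E]] := limit phi hphi.
exists psi' => //.
have EF : \int[ls F]_x h x = \int[ls F']_x h x.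
  apply: eq_int_measure; apply: char_fun_measure_unique => [||t|t];
    try exact: prob_lty.
  - by have := etrans (FE t) (esym (F'E t)); rewrite !char_funE => -[].
  - by have := etrans (FE t) (esym (F'E t)); rewrite !char_funE => -[].
by rewrite -/(ls F) EF; exact: wF'.
Qed.
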